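(* Consider the generalised ant with rule word $w = LLRRRL$ (so $|w|=6$). Then: (1) there exists a finite configuration from which this ant is in a highway whose drift is not a multiple of $(1,1)$ or of $(1,-1)$ (a non-diagonal highway); (2) there exists a finite configuration from which this ant has an increasing rectangle behaviour; (3) there exist infinitely many pairwise inequivalent diagonal highways of this ant, each of which the ant is in from some finite configuration.
   Context: Let $Q=\{(0,1),(1,0),(0,-1),(-1,0)\}$ be the set of directions, with counterclockwise rotation $t^{\circlearrowleft}$ and clockwise rotation $t^{\circlearrowright}$ (rotations by $\pm 90^\circ$). For a word $w\in\{L,R\}^*$, an ant configuration is a triple $(c,(i,j),q)$ with $c\in\{0,\dots,|w|-1\}^{\mathbb{Z}^2}$, $(i,j)\in\mathbb{Z}^2$, $q\in Q$. The generalised ant $T_w$ maps $(c,(i,j),q)$ to $(c',(i',j'),q')$ where, with $k=c_{i,j}$: $q'=t^{\circlearrowright}(q)$ if $w_k=R$ and $q'=t^{\circlearrowleft}(q)$ if $w_k=L$; $(i',j')=(i,j)+q'$; $c'_{i,j}=c_{i,j}+1 \bmod |w|$; $c'_{k,l}=c_{k,l}$ for $(k,l)\ne(i,j)$. A configuration is finite if $c$ has only finitely many nonzero cells. The trace from $C$ is the sequence of cell states $c_{i,j}$ read by the ant at successive steps (an element of $\{0,\dots,|w|-1\}^{\mathbb{N}}$) and the trajectory is the sequence $(\mathbf{y}_n)_{n\in\mathbb{N}}$ of its positions. Highway: the ant is in a highway of period $n$ and drift $(a,b)$ from $C$ if $C$ is finite, the trace $x$ satisfies $x_{i+n}=x_i$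 for all $i$ (with $n$ minimal), and the trajectory satisfies $\mathbf{y}_{i+n}=\mathbf{y}_i+(a,b)$ for all $i$. Two highways are equivalent if their traces and trajectories coincide after removing a finite prefix from both. A highway is diagonal if its drift is a multiple of $(\pm1,\pm1)$. Interlaced word: $x\in\mathcal{A}^{\mathbb{N}}$ is interlaced if there exist $k\ge 1$ and words $u_i,v_i\in\mathcal{A}^*$ ($0\le i<k$) with $x=t_0t_1t_2\cdots$ where $t_n=u_0v_0^n u_1 v_1^n\cdots u_{k-1}v_{k-1}^n$. Previsible trajectory: for a compact $\Delta\subset\mathbb{R}^2$ containing $0$, a trajectory $\mathbf{y}$ is $\Delta$-previsible if there exist non-decreasing $f,g:\mathbb{N}\to\mathbb{R}^+$, an integer $k$ and a nonzero vector $\vec d\in\mathbb{R}^2$ such that (i) for all $n$, $\mathbf{y}_n\in\partial_k(f(n)\Delta+g(n)\vec d)$, and (ii) for every $p\in\partial\Delta$ and every $N$ there is $n\ge N$ with $d(\mathbf{y}_n, f(n)p+g(n)\vec d)\le k$. Here $f(n)X+g(n)\vec d$ is the dilation of $X$ by $f(n)$ about $0$ translated by $g(n)\vec d$, $\partial X$ is the boundary and $\partial_k X$ the set of points at distance at most $k$ from $\partial X$. The behaviour is increasing if $f(n)\to+\infty$ and drifting if $g(n)\to+\infty$ (non-drifting otherwise). Emergent behaviour from $C$: the trace is eventually interlaced and the trajectory is $\Delta$-previsible for some compact $\Delta$. Increasing rectangle behaviour: an increasing, non-drifting emergent behaviour where $\Delta$ is a rectangle. *)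

(* Defs.v *)
From Stdlib Require Import Reals ZArith List Arith.
Import ListNotations.
Local Open Scope R_scope.

Inductive letter : Type := TurnL | TurnR.

Inductive dir : Type := DN | DE | DS | DW.

Definition dir_vec (q : dir) : Z * Z :=
  match q with
  | DN => (0%Z, 1%Z) | DE => (1%Z, 0%Z) | DS => (0%Z, (-1)%Z) | DW => ((-1)%Z, 0%Z)
  end.

Definition rot_cw (q : dir) : dir :=
  match q with DN => DE | DE => DS | DS => DW | DW => DN end.
Definition rot_ccw (q : dir) : dir :=
  match q with DN => DW | DW => DS | DS => DE | DE => DN end.

Record ant_config : Type := mkConfig {
  cells : Z * Z -> nat;
  pos : Z * Z;
  heading : dir }.

Definition addZ2 (p q : Z * Z) : Z * Z := (fst p + fst q, snd p + snd q)%Z.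

Definition cell_update (c : Z * Z -> nat) (p : Z * Z) (v : nat) : Z * Z -> nat :=
  fun p' => if (Z.eqb (fst p') (fst p) && Z.eqb (snd p') (snd p))%bool then v else c p'.

Definition ant_step (w : list letter) (C : ant_config) : ant_config :=
  let k := cells C (pos C) in
  let q' := match nth k w TurnL with
            | TurnR => rot_cw (heading C)
            | TurnL => rot_ccw (heading C)
            end in
  mkConfig (cell_update (cells C) (pos C) ((k + 1) mod length w))
           (addZ2 (pos C) (dir_vec q')) q'.

Definition ant_iter (w : list letter) (n : nat) (C : ant_config) : ant_config :=
  Nat.iter n (ant_step w) C.

Definition valid_config (w : list letter) (C : ant_config) : Prop :=
  forall p, (cells C p < length w)%nat.

Definition finite_config (w : list letter) (C : ant_config) : Prop :=
  valid_config w C /\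
  exists S : list (Z * Z), forall p, ~ In p S -> cells C p = 0%nat.

Definition trace (w : list letter) (C : ant_config) (n : nat) : nat :=
  let D := ant_iter w n C in cells D (pos D).

Definition trajectory (w : list letter) (C : ant_config) (n : nat) : Z * Z :=
  pos (ant_iter w n C).

Definition is_highway (w : list letter) (C : ant_config) (n : nat) (a b : Z) : Prop :=
  finite_config w C /\
  (0 < n)%nat /\
  (forall i, trace w C (i + n) = trace w C i) /\
  (forall m, (0 < m < n)%nat -> ~ (forall i, trace w C (i + m) = trace w C i)) /\
  (forall i, trajectory w C (i + n) = addZ2 (trajectory w C i) (a, b)).

Definition diagonal_drift (a b : Z) : Prop := a = b \/ a = (- b)%Z.

Definition highway_equiv (w : list letter) (C1 C2 : ant_config) : Prop :=
  exists (m1 m2 : nat) (t : Z * Z), forall i,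
    trace w C1 (m1 + i) = trace w C2 (m2 + i) /\
    trajectory w C1 (m1 + i) = addZ2 (trajectory w C2 (m2 + i)) t.

Definition interlace_block (uv : list (list nat * list nat)) (n : nat) : list nat :=
  flat_map (fun p => fst p ++ concat (repeat (snd p) n)) uv.

Definition interlace_prefix (uv : list (list nat * list nat)) (N : nat) : list nat :=
  concat (map (interlace_block uv) (seq 0 N)).

(** x = t_0 t_1 t_2 ... with t_n = u_0 v_0^n ... u_{k-1} v_{k-1}^n, k >= 1 *)
Definition interlaced (x : nat -> nat) : Prop :=
  exists uv : list (list nat * list nat),
    uv <> [] /\
    (forall N i, (i < length (interlace_prefix uv N))%nat ->
                 x i = nth i (interlace_prefix uv N) 0%nat) /\
    (forall M, exists N, (M <= length (interlace_prefix uv N))%nat).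

Definition eventually_interlaced (x : nat -> nat) : Prop :=
  exists m, interlaced (fun i => x (m + i)%nat).

Definition pt := (R * R)%type.

Definition dist2 (p q : pt) : R :=
  sqrt ((fst p - fst q)^2 + (snd p - snd q)^2).

Definition toR2 (p : Z * Z) : pt := (IZR (fst p), IZR (snd p)).

Definition boundary (X : pt -> Prop) (p : pt) : Prop :=
  forall eps : R, 0 < eps ->
    (exists q, X q /\ dist2 p q < eps) /\ (exists q, ~ X q /\ dist2 p q < eps).

Definition near_boundary (k : R) (X : pt -> Prop) (p : pt) : Prop :=
  exists q, boundary X q /\ dist2 p q <= k.

Definition dil_trans (f g : R) (d : pt) (X : pt -> Prop) : pt -> Prop :=
  fun p => exists q, X q /\ p = (f * fst q + g * fst d, f * snd q + g * snd d).

Definition closed_set (X : pt -> Prop) : Prop :=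
  forall p, (forall eps, 0 < eps -> exists q, X q /\ dist2 p q < eps) -> X p.

Definition bounded_set (X : pt -> Prop) : Prop :=
  exists M, forall p, X p -> dist2 p (0, 0) <= M.

(** compact subsets of R^2 (Heine-Borel) *)
Definition compact_set (X : pt -> Prop) : Prop := closed_set X /\ bounded_set X.

Definition nondecreasing (f : nat -> R) : Prop := forall m n, (m <= n)%nat -> f m <= f n.

Definition tends_to_infty (f : nat -> R) : Prop :=
  forall M, exists N, forall n, (N <= n)%nat -> M <= f n.

Definition previsible_with (Delta : pt -> Prop) (y : nat -> Z * Z)
    (f g : nat -> R) (k : Z) (d : pt) : Prop :=
  (forall n, 0 <= f n) /\ (forall n, 0 <= g n) /\
  nondecreasing f /\ nondecreasing g /\
  d <> (0, 0) /\
  (forall n, near_boundary (IZR k) (dil_trans (f n) (g n) d Delta) (toR2 (y n))) /\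
  (forall p, boundary Delta p -> forall N, exists n, (N <= n)%nat /\
      dist2 (toR2 (y n)) (f n * fst p + g n * fst d, f n * snd p + g n * snd d)
        <= IZR k).

Definition is_rectangle (Delta : pt -> Prop) : Prop :=
  exists (c u v : pt),
    u <> (0, 0) /\ v <> (0, 0) /\ fst u * fst v + snd u * snd v = 0 /\
    forall z, Delta z <-> exists s t, 0 <= s <= 1 /\ 0 <= t <= 1 /\
       z = (fst c + s * fst u + t * fst v, snd c + s * snd u + t * snd v).

(** Increasing rectangle behaviour from C: increasing, non-drifting emergent
    behaviour with Delta a rectangle. *)
Definition increasing_rectangle_behaviour (w : list letter) (C : ant_config) : Prop :=
  eventually_interlaced (trace w C) /\
  exists (Delta : pt -> Prop) (f g : nat -> R) (k : Z) (d : pt),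
    compact_set Delta /\ Delta (0, 0) /\ is_rectangle Delta /\
    previsible_with Delta (trajectory w C) f g k d /\
    tends_to_infty f /\ ~ tends_to_infty g.

Definition w_LLRRRL : list letter := [TurnL; TurnL; TurnR; TurnR; TurnR; TurnL].

(* Main.v *)
From Stdlib Require Import String Ascii.
From Stdlib Require Import Reals ZArith List Arith Lia Lra Bool.
Require Import Defs.
Import ListNotations.

(** A finite configuration is turned into a verified computation by locality: the ant only
    sees the cells it visits, so a run on a finite table is reproduced, translated, by every
    configuration that agrees with the table on the visited region. If a table contains a
    two-cell wide block that the ant traverses and leaves on the other side, then in the
    configuration where the block is repeated [K] times the ant makes [K] traversals.

    The vertical highway is a single table. The diagonal highways come from one table in which
    a block of the horizontal front is repeated [K] times: the period is [1472 + 96 K] and the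
    drift is [(4, 4)], so the speeds are pairwise different.

    In the growing square, the ant winds counterclockwise around a square of cells in state 4,
    zigzagging on two rows whose outer cells turn it left and whose inner cells turn it
    right. Two turns push every side outwards by one cell; a seam near the bottom
    left corner moves the ant to the next ring. After four turns all sides have moved by two
    cells and the pattern near the four corners has reproduced itself, so the [n]-th such cycle is
    obtained from a table by repeating [2 n + 1] times a block on each side. *)

Local Open Scope Z_scope.

(** * Arithmetic of positions and single-cell updates *)

Lemma ant_iter_add w m n C : ant_iter w (m + n) C = ant_iter w m (ant_iter w n C).
Proof. apply Nat.iter_add. Qed.

Ltac z2 := repeat match goal with p : (Z * Z)%type |- _ => destruct p end;
  unfold addZ2 in *; cbn [fst snd] in *.
Ltac z2eq := z2; f_equal; ring.

Lemma Z2_eqb_spec (p q : Z * Z) :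
  (Z.eqb (fst p) (fst q) && Z.eqb (snd p) (snd q))%bool = true <-> p = q.
Proof.
  destruct p as [x y], q as [x' y']; cbn.
  rewrite andb_true_iff, !Z.eqb_eq. split; [intros [-> ->]; reflexivity | intros [= -> ->]; auto].
Qed.

Lemma Z2_eq_dec (p q : Z * Z) : {p = q} + {p <> q}.
Proof. decide equality; apply Z.eq_dec. Qed.

Lemma cell_update_eq c p v : cell_update c p v p = v.
Proof. unfold cell_update. now rewrite (proj2 (Z2_eqb_spec p p) eq_refl). Qed.

Lemma cell_update_neq c p v q : q <> p -> cell_update c p v q = c q.
Proof.
  intros H. unfold cell_update.
  destruct (Z.eqb (fst q) (fst p) && Z.eqb (snd q) (snd p))%bool eqn:E; [|reflexivity].
  now apply Z2_eqb_spec in E.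
Qed.

Lemma addZ2_inj_r p q t : addZ2 p t = addZ2 q t -> p = q.
Proof. z2. intros [= H1 H2]. f_equal; lia. Qed.

(** * Runs with recorded trace *)

(** [V] bounds the cells that are read, not the final position, so runs within the same [V] can be
    concatenated. *)
Definition runs (w : list letter) (V : Z * Z -> Prop) (C : ant_config) (tr : list nat)
    (C' : ant_config) : Prop :=
  C' = ant_iter w (length tr) C /\
  forall i, (i < length tr)%nat ->
    trace w C i = nth i tr 0%nat /\ V (trajectory w C i).

Lemma runs_nil w V C : runs w V C [] C.
Proof. split; [reflexivity|]. cbn. lia. Qed.

Lemma trace_add w m i C : trace w C (m + i) = trace w (ant_iter w m C) i.
Proof. unfold trace. now rewrite Nat.add_comm, ant_iter_add. Qed.

Lemma trajectory_add w m i C : trajectory w C (m + i) = trajectory w (ant_iter w m C) i.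
Proof. unfold trajectory. now rewrite Nat.add_comm, ant_iter_add. Qed.

Lemma runs_app w V C tr1 C1 tr2 C2 :
  runs w V C tr1 C1 -> runs w V C1 tr2 C2 -> runs w V C (tr1 ++ tr2) C2.
Proof.
  intros [-> H1] [-> H2]. split.
  - rewrite length_app, Nat.add_comm, ant_iter_add. reflexivity.
  - intros i Hi. rewrite length_app in Hi.
    destruct (Nat.lt_ge_cases i (length tr1)) as [Hlt|Hge].
    + rewrite app_nth1 by lia. auto.
    + rewrite app_nth2 by lia.
      replace i with (length tr1 + (i - length tr1))%nat at 1 3 by lia.
      rewrite trace_add, trajectory_add. apply H2. lia.
Qed.

Lemma runs_weaken w (V V' : Z * Z -> Prop) C tr C' :
  (forall p, V p -> V' p) -> runs w V C tr C' -> runs w V' C tr C'.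
Proof. intros HV [-> H]. split; [reflexivity|]. intros i Hi. destruct (H i Hi); auto. Qed.

(** * Simulation on finite tables *)

(* Row [y] of the table lists the states of the cells [(0, y), (1, y), ...]; all other
   cells are in state 0. *)
Definition look (t : list (list nat)) (p : Z * Z) : nat :=
  if (fst p <? 0) || (snd p <? 0) then 0%nat
  else nth (Z.to_nat (fst p)) (nth (Z.to_nat (snd p)) t []) 0%nat.

Fixpoint set_nth {A : Type} (n : nat) (v : A) (l : list A) : list A :=
  match l, n with
  | [], _ => []
  | _ :: l', 0%nat => v :: l'
  | a :: l', S n' => a :: set_nth n' v l'
  end.

Lemma nth_set_nth {A : Type} n (v : A) l m d :
  (n < length l)%nat ->
  nth m (set_nth n v l) d = if Nat.eqb m n then v else nth m l d.
Proof.
  revert n m. induction l as [|a l IH]; intros n m H; cbn in H; [lia|].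
  destruct n, m; cbn; auto. apply IH. lia.
Qed.

Definition in_table (t : list (list nat)) (p : Z * Z) : bool :=
  (0 <=? fst p) && (0 <=? snd p) &&
  (Z.to_nat (snd p) <? length t)%nat &&
  (Z.to_nat (fst p) <? length (nth (Z.to_nat (snd p)) t []))%nat.

Definition upd (t : list (list nat)) (p : Z * Z) (v : nat) : list (list nat) :=
  set_nth (Z.to_nat (snd p)) (set_nth (Z.to_nat (fst p)) v (nth (Z.to_nat (snd p)) t [])) t.

Lemma look_upd t p v q : in_table t p = true ->
  look (upd t p v) q = cell_update (look t) p v q.
Proof.
  destruct p as [x y], q as [x' y']. unfold in_table, look, upd, cell_update; cbn [fst snd].
  rewrite !andb_true_iff, !Z.leb_le, !Nat.ltb_lt. intros [[[Hx Hy] Hy'] Hx'].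
  destruct (Z.ltb_spec x' 0); cbn [orb].
  { destruct (Z.eqb_spec x' x); [lia|reflexivity]. }
  destruct (Z.ltb_spec y' 0); cbn [orb].
  { destruct (Z.eqb_spec y' y); [lia|]. now rewrite andb_false_r. }
  rewrite nth_set_nth by assumption.
  destruct (Z.eqb_spec y' y) as [->|Hne].
  - rewrite Nat.eqb_refl, nth_set_nth by assumption.
    rewrite andb_true_r. destruct (Z.eqb_spec x' x) as [->|Hne].
    + now rewrite Nat.eqb_refl.
    + destruct (Nat.eqb_spec (Z.to_nat x') (Z.to_nat x)); [lia|reflexivity].
  - rewrite andb_false_r.
    destruct (Nat.eqb_spec (Z.to_nat y') (Z.to_nat y)); [lia|reflexivity].
Qed.

Record tconfig : Type := mkT { tab : list (list nat); tpos : Z * Z; thead : dir }.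

Definition turn_of (w : list letter) (k : nat) (q : dir) : dir :=
  match nth k w TurnL with TurnR => rot_cw q | TurnL => rot_ccw q end.

(** Success is a certificate: every cell read lies in [Q] and among the stored cells, which [upd]
    cannot extend. *)
Fixpoint trun (w : list letter) (Q : Z * Z -> bool) (n : nat) (s : tconfig)
    : option (list nat * tconfig) :=
  match n with
  | 0%nat => Some ([], s)
  | S n' =>
      if Q (tpos s) && in_table (tab s) (tpos s) then
        let k := look (tab s) (tpos s) in
        let q := turn_of w k (thead s) in
        match trun w Q n' (mkT (upd (tab s) (tpos s) ((k + 1) mod length w))
                               (addZ2 (tpos s) (dir_vec q)) q) with
        | Some (tr, s') => Some (k :: tr, s')
        | None => None
        end
      else None
  end.

Definition docked (E : ant_config) (s : tconfig) (t : Z * Z) : Prop :=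
  pos E = addZ2 (tpos s) t /\ heading E = thead s.

(** Agreement is relative to a region and an offset, so that one configuration can contain many
    translated pieces of the same table. *)
Definition matches (Q : Z * Z -> bool) (E : ant_config) (s : tconfig) (t : Z * Z) : Prop :=
  forall p, Q p = true -> cells E (addZ2 p t) = look (tab s) p.

(** Each cell read lies in [Q], where [E] and the table agree up to [t], so both make the same turn
    and the same update. The last two clauses are frame conditions: neither side changes outside
    [Q]. *)
Lemma trun_sound w Q n : forall s E t tr s',
  trun w Q n s = Some (tr, s') ->
  docked E s t -> matches Q E s t ->
  exists E',
    runs w (fun p => exists q, Q q = true /\ p = addZ2 q t) E tr E' /\
    length tr = n /\
    docked E' s' t /\ matches Q E' s' t /\
    (forall p, (forall q, Q q = true -> p <> addZ2 q t) -> cells E' p = cells E p) /\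
    (forall p, Q p = false -> look (tab s') p = look (tab s) p).
Proof.
  induction n as [|n IH]; cbn; intros s E t tr s' Hrun Hd Hm.
  - injection Hrun as <- <-. exists E.
    split; [apply runs_nil|]. repeat split; auto; apply Hd.
  - destruct (Q (tpos s) && in_table (tab s) (tpos s))%bool eqn:HQ; [|discriminate].
    apply andb_true_iff in HQ. destruct HQ as [HQ Hin].
    set (k := look (tab s) (tpos s)) in *.
    set (q := turn_of w k (thead s)) in *.
    destruct (trun w Q n _) as [[tr1 s1]|] eqn:Hr; [|discriminate].
    injection Hrun as <- <-.
    destruct Hd as [Hp Hh].
    assert (Hk : cells E (pos E) = k) by (rewrite Hp; now apply Hm).
    assert (Hst : ant_step w E =
        mkConfig (cell_update (cells E) (pos E) ((k + 1) mod length w))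
                 (addZ2 (pos E) (dir_vec q)) q).
    { unfold ant_step. rewrite Hk, Hh. reflexivity. }
    destruct (IH _ (ant_step w E) t _ _ Hr) as (E' & HR & Hl & Hd' & Hm' & Hf & Hg).
    + rewrite Hst. split; cbn; [|reflexivity]. rewrite Hp. z2eq.
    + intros p HQp. rewrite Hst. cbn [cells tab].
      rewrite look_upd by assumption.
      destruct (Z2_eq_dec p (tpos s)) as [->|Hne].
      * rewrite <- Hp, !cell_update_eq. reflexivity.
      * rewrite !cell_update_neq; auto. rewrite Hp. intros Heq. now apply addZ2_inj_r in Heq.
    + exists E'. split; [|split; [cbn; lia|split; [assumption|split; [assumption|split]]]].
      * apply (runs_app w _ E [k] (ant_step w E) tr1); [|assumption].
        split; [reflexivity|]. cbn. intros i Hi. replace i with 0%nat by lia.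
        split; [exact Hk|]. exists (tpos s). split; [assumption|exact Hp].
      * intros p Hpq. rewrite Hf by assumption. rewrite Hst. cbn [cells].
        apply cell_update_neq. rewrite Hp. now apply Hpq.
      * intros p HQp. rewrite Hg by assumption. cbn [tab].
        rewrite look_upd by assumption. apply cell_update_neq. intros ->. congruence.
Qed.

(** * Sweeping a strip made of repeated blocks *)

Definition smul (j : Z) (u : Z * Z) : Z * Z := (j * fst u, j * snd u).

Lemma concat_repeat_succ {A : Type} (l : list A) (n : nat) :
  concat (repeat l (S n)) = concat (repeat l n) ++ l.
Proof.
  induction n as [|n IH]; cbn; [now rewrite app_nil_r|].
  cbn in IH. rewrite IH at 1. now rewrite app_assoc.
Qed.

Lemma length_concat_repeat {A : Type} (l : list A) (n : nat) :
  length (concat (repeat l n)) = (n * length l)%nat.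
Proof. induction n as [|n IH]; cbn; [reflexivity|]. now rewrite length_app, IH. Qed.

(* One traversal turns a window [W] followed by a block [B] into a block [A] followed by
   the same window, displaced by [u]; iterating it carries the window through [K] copies
   of [B]. *)
Lemma sweep_sound w (Q W B : Z * Z -> bool) (u t0 : Z * Z) n s s' tr (K : nat) E
    (A := fun p => (W p || B p) && negb (W (addZ2 p (smul (-1) u)))) :
  trun w Q n s = Some (tr, s') ->
  tpos s' = addZ2 (tpos s) u -> thead s' = thead s ->
  (forall p, Q p = true -> W p || B p = true) ->
  (forall p, W p = true ->
     W (addZ2 p u) || B (addZ2 p u) = true /\
     look (tab s') (addZ2 p u) = look (tab s) p) ->
  (forall p j, 1 <= j -> B p = true -> Q (addZ2 p (smul j u)) = false) ->
  (forall p j, 1 <= j -> A p = true -> Q (addZ2 p (smul (- j) u)) = false) ->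
  docked E s t0 -> matches W E s t0 ->
  (forall j, 0 <= j < Z.of_nat K -> matches B E s (addZ2 t0 (smul j u))) ->
  exists E',
    runs w (fun p => exists j q, 0 <= j < Z.of_nat K /\ Q q = true /\
                       p = addZ2 q (addZ2 t0 (smul j u)))
      E (concat (repeat tr K)) E' /\
    docked E' s (addZ2 t0 (smul (Z.of_nat K) u)) /\
    matches W E' s (addZ2 t0 (smul (Z.of_nat K) u)) /\
    (forall j, 0 <= j < Z.of_nat K -> matches A E' s' (addZ2 t0 (smul j u))) /\
    (forall p, (forall j q, 0 <= j < Z.of_nat K -> Q q = true ->
                  p <> addZ2 q (addZ2 t0 (smul j u))) ->
               cells E' p = cells E p) /\
    (forall i, (i < K)%nat ->
       trajectory w E (i * n) = addZ2 (tpos s) (addZ2 t0 (smul (Z.of_nat i) u))).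
Proof.
  intros Hrun Hpos Hhd HQ HW HB HA Hd HmW HmB.
  (* After [i] traversals the blocks from [i] on are untouched, the earlier ones have their final
     form, and the window stands in front of block [i]. *)
  assert (Main : forall i : nat, (i <= K)%nat -> exists Ei,
    runs w (fun p => exists j q, 0 <= j < Z.of_nat i /\ Q q = true /\
                       p = addZ2 q (addZ2 t0 (smul j u)))
      E (concat (repeat tr i)) Ei /\
    docked Ei s (addZ2 t0 (smul (Z.of_nat i) u)) /\
    matches W Ei s (addZ2 t0 (smul (Z.of_nat i) u)) /\
    (forall j, Z.of_nat i <= j < Z.of_nat K -> matches B Ei s (addZ2 t0 (smul j u))) /\
    (forall j, 0 <= j < Z.of_nat i -> matches A Ei s' (addZ2 t0 (smul j u))) /\
    (forall p, (forall j q, 0 <= j < Z.of_nat i -> Q q = true ->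
                  p <> addZ2 q (addZ2 t0 (smul j u))) ->
               cells Ei p = cells E p) /\
    (forall i', (i' < i)%nat ->
       trajectory w E (i' * n) = addZ2 (tpos s) (addZ2 t0 (smul (Z.of_nat i') u)))).
  { induction i as [|i IH]; intros Hi.
    - exists E. split; [apply runs_nil|].
      assert (Ht : addZ2 t0 (smul (Z.of_nat 0) u) = t0) by (unfold smul; z2eq).
      rewrite Ht. repeat split; auto; try apply Hd; try lia.
    - destruct IH as (Ei & HR & Hdi & HmWi & HmBi & HmAi & Hfi & Hti); [lia|].
      set (ti := addZ2 t0 (smul (Z.of_nat i) u)) in *.
      assert (HmQ : forall p, W p || B p = true -> cells Ei (addZ2 p ti) = look (tab s) p).
      { intros p Hp. destruct (W p) eqn:Ew; [now apply HmWi|].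
        apply (HmBi (Z.of_nat i)); [lia|exact Hp]. }
      destruct (trun_sound w Q n s Ei ti tr s' Hrun Hdi) as
        (E1 & HR1 & Hl & Hd1 & Hm1 & Hf1 & Hg1); [intros p Hp; apply HmQ; auto|].
      assert (Ht : addZ2 t0 (smul (Z.of_nat (S i)) u) = addZ2 u ti).
      { unfold ti, smul. rewrite Nat2Z.inj_succ. z2eq. }
      (* Window and block are known entirely after the traversal: inside [Q] by simulation, outside
         [Q] by the two frame conditions. *)
      assert (Hnew : forall p, W p || B p = true -> cells E1 (addZ2 p ti) = look (tab s') p).
      { intros p Hp. destruct (Q p) eqn:EQ; [now apply Hm1|].
        rewrite Hf1, HmQ, Hg1; auto.
        intros q Hq Heq. apply addZ2_inj_r in Heq. congruence. }
      exists E1. split; [|split; [|split; [|split; [|split; [|split]]]]].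
      + rewrite concat_repeat_succ. eapply runs_app; [eapply runs_weaken; [|exact HR]|].
        * cbn. intros p (j & q & Hj & Hq & ->). exists j, q. repeat split; auto; lia.
        * eapply runs_weaken; [|exact HR1]. cbn. intros p (q & Hq & ->).
          exists (Z.of_nat i), q. repeat split; auto; lia.
      + rewrite Ht. destruct Hd1 as [Hp1 Hh1]. split; [|congruence].
        rewrite Hp1, Hpos. z2eq.
      + rewrite Ht. intros p Hp. destruct (HW p Hp) as [Hwb Hlk].
        replace (addZ2 p (addZ2 u ti)) with (addZ2 (addZ2 p u) ti) by z2eq.
        rewrite Hnew; auto.
      + intros j Hj p Hp. rewrite Hf1; [apply HmBi; auto; lia|].
        intros q Hq Heq.
        (* Seen from traversal [i], this cell lies [j - i] blocks ahead, which [HB] excludes from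
           [Q]. *)
        assert (q = addZ2 p (smul (j - Z.of_nat i) u)) as ->.
        { revert Heq. unfold ti, smul. z2. intros [= H1 H2]. f_equal; lia. }
        rewrite HB in Hq; [discriminate|lia|assumption].
      + intros j Hj p Hp. destruct (Z.eq_dec j (Z.of_nat i)) as [->|Hne].
        * apply Hnew. unfold A in Hp. now apply andb_true_iff in Hp.
        * rewrite Hf1; [apply HmAi; auto; lia|].
          intros q Hq Heq.
          assert (q = addZ2 p (smul (- (Z.of_nat i - j)) u)) as ->.
          { revert Heq. unfold ti, smul. z2. intros [= H1 H2]. f_equal; lia. }
          rewrite HA in Hq; [discriminate|lia|assumption].
      + intros p Hp. rewrite Hf1.
        * apply Hfi. intros j q Hj. apply Hp. lia.
        * intros q Hq. apply Hp; auto. lia.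
      + intros i' Hi'. destruct (Nat.eq_dec i' i) as [->|Hne]; [|apply Hti; lia].
        destruct HR as [HE _]. rewrite length_concat_repeat, Hl in HE.
        unfold trajectory. rewrite <- HE. apply Hdi. }
  destruct (Main K (Nat.le_refl K)) as (E' & H1 & H2 & H3 & H4 & H5 & H6 & H7).
  exists E'. auto 10.
Qed.

(** * Highways *)

Lemma ant_step_translate w (R : Z * Z -> Prop) d C1 C2 :
  pos C1 = addZ2 (pos C2) d -> heading C1 = heading C2 ->
  (forall p, R p -> cells C1 (addZ2 p d) = cells C2 p) -> R (pos C2) ->
  pos (ant_step w C1) = addZ2 (pos (ant_step w C2)) d /\
  heading (ant_step w C1) = heading (ant_step w C2) /\
  (forall p, R p -> cells (ant_step w C1) (addZ2 p d) = cells (ant_step w C2) p).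
Proof.
  intros Hp Hh Hc HR.
  assert (Hk : cells C1 (pos C1) = cells C2 (pos C2)) by (rewrite Hp; auto).
  unfold ant_step. rewrite Hk, Hh. cbn [pos heading cells].
  split; [|split; [reflexivity|]].
  - rewrite Hp. generalize (dir_vec (match nth (cells C2 (pos C2)) w TurnL with
      | TurnL => rot_ccw (heading C2) | TurnR => rot_cw (heading C2) end)).
    generalize (pos C2). intros. z2eq.
  - intros p Hp'. destruct (Z2_eq_dec p (pos C2)) as [->|Hne].
    + now rewrite <- Hp, !cell_update_eq.
    + rewrite !cell_update_neq; auto. rewrite Hp. intros He. now apply addZ2_inj_r in He.
Qed.

Definition drifts (w : list letter) (C : ant_config) (n : nat) (d : Z * Z) : Prop :=
  forall i, trace w C (i + n) = trace w C i /\
            trajectory w C (i + n) = addZ2 (trajectory w C i) d.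

(* The part of the plane ahead of the ant, [R], is all that matters for its future. *)
Lemma drifts_of_translate w C n d (R : Z * Z -> Prop) :
  (0 < n)%nat ->
  (forall p, R p -> R (addZ2 p d)) ->
  (forall i, (i < n)%nat -> R (trajectory w C i)) ->
  pos (ant_iter w n C) = addZ2 (pos C) d ->
  heading (ant_iter w n C) = heading C ->
  (forall p, R p -> cells (ant_iter w n C) (addZ2 p d) = cells C p) ->
  drifts w C n d.
Proof.
  intros Hn HR Hvis Hp Hh Hc.
  (* Induction up to a bound [m]: at a time [i >= n] the ant stands at the translate by [d] of its
     position at time [i - n], and [R] is stable under [d]. *)
  assert (Main : forall m i, (i <= m)%nat ->
    R (trajectory w C i) /\
    pos (ant_iter w (i + n) C) = addZ2 (pos (ant_iter w i C)) d /\
    heading (ant_iter w (i + n) C) = heading (ant_iter w i C) /\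
    (forall p, R p -> cells (ant_iter w (i + n) C) (addZ2 p d) = cells (ant_iter w i C) p)).
  { induction m as [|m IH]; intros i Hi.
    - replace i with 0%nat by lia. cbn. split; [apply (Hvis 0%nat); lia|]. auto.
    - destruct i as [|i]; [apply IH; lia|].
      destruct (IH i) as (Hi1 & Hi2 & Hi3 & Hi4); [lia|].
      split; [|apply (ant_step_translate w R d); assumption].
      destruct (Nat.lt_ge_cases (S i) n) as [Hlt|Hge]; [now apply Hvis|].
      destruct (IH (S i - n)%nat) as (Hj1 & Hj2 & _); [lia|].
      unfold trajectory. replace (S i) with (S i - n + n)%nat by lia.
      rewrite Hj2. now apply HR. }
  intros i. destruct (Main i i (Nat.le_refl i)) as (H1 & H2 & H3 & H4).
  unfold trace, trajectory. split; [|assumption]. rewrite H2. now apply H4.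
Qed.

(** * Rotations of the trajectory and minimal periods *)

Definition rotv (v : Z * Z) : Z * Z := (snd v, - fst v).

Lemma heading_turn w C i :
  heading (ant_iter w (S i) C) = turn_of w (trace w C i) (heading (ant_iter w i C)).
Proof. reflexivity. Qed.

Lemma pos_turn w C i :
  trajectory w C (S i) = addZ2 (trajectory w C i) (dir_vec (heading (ant_iter w (S i) C))).
Proof. reflexivity. Qed.

Lemma turn_rot w k j q :
  turn_of w k (Nat.iter j rot_cw q) = Nat.iter j rot_cw (turn_of w k q).
Proof.
  induction j as [|j IH]; [reflexivity|]. rewrite !Nat.iter_succ, <- IH.
  unfold turn_of. destruct (nth k w TurnL), (Nat.iter j rot_cw q); reflexivity.
Qed.

Lemma dir_vec_rot j q : dir_vec (Nat.iter j rot_cw q) = Nat.iter j rotv (dir_vec q).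
Proof.
  induction j as [|j IH]; [reflexivity|]. rewrite !Nat.iter_succ, <- IH.
  destruct (Nat.iter j rot_cw q); reflexivity.
Qed.

Lemma rotv_add j a b : Nat.iter j rotv (addZ2 a b) = addZ2 (Nat.iter j rotv a) (Nat.iter j rotv b).
Proof.
  induction j as [|j IH]; [reflexivity|]. rewrite !Nat.iter_succ, IH.
  unfold rotv, addZ2. cbn. f_equal. ring.
Qed.

Lemma drift_iter w C n d : drifts w C n d -> forall k i,
  trajectory w C (i + k * n) = addZ2 (trajectory w C i) (smul (Z.of_nat k) d).
Proof.
  intros H. induction k as [|k IH]; intros i.
  - cbn [Nat.mul]. rewrite Nat.add_0_r. unfold smul. generalize (trajectory w C i). intros; z2eq.
  - replace (i + S k * n)%nat with (i + k * n + n)%nat by lia.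
    rewrite (proj2 (H _)), IH, Nat2Z.inj_succ. unfold smul.
    generalize (trajectory w C i). intros; z2eq.
Qed.

(* A period of the trace may rotate the heading; but then four periods bring the ant back
   to its starting point, which a nonzero drift forbids. *)
Lemma trace_period_drifts w C n d m :
  drifts w C n d -> d <> (0, 0) -> (0 < m)%nat ->
  (forall i, trace w C (i + m) = trace w C i) ->
  exists d', drifts w C m d'.
Proof.
  intros Hdr Hd Hm Hper.
  assert (exists j, (j < 4)%nat /\ heading (ant_iter w m C) = Nat.iter j rot_cw (heading C)) as (j & Hj & Hj0).
  { destruct (heading (ant_iter w m C)), (heading C);
      first [exists 0%nat; split; [lia|reflexivity] | exists 1%nat; split; [lia|reflexivity]
            |exists 2%nat; split; [lia|reflexivity] | exists 3%nat; split; [lia|reflexivity]]. }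
  assert (Hh : forall i, heading (ant_iter w (i + m) C) = Nat.iter j rot_cw (heading (ant_iter w i C))).
  { induction i as [|i IH]; [exact Hj0|].
    cbn [Nat.add]. now rewrite !heading_turn, IH, Hper, turn_rot. }
  (* A displacement over [l] steps reappears [m] steps later, rotated by [j] quarter turns. *)
  assert (Hdisp : forall i l v, trajectory w C (i + l) = addZ2 (trajectory w C i) v ->
     trajectory w C (i + l + m) = addZ2 (trajectory w C (i + m)) (Nat.iter j rotv v)).
  { intros i l. induction l as [|l IH]; intros v Hv.
    - rewrite Nat.add_0_r in *. assert (v = (0, 0)) as ->.
      { revert Hv. generalize (trajectory w C i). z2. intros [a b] [= H1 H2]. f_equal; lia. }
      replace (Nat.iter j rotv (0, 0)) with ((0, 0) : Z * Z)
        by (clear; induction j as [|j IH]; [reflexivity|]; now rewrite Nat.iter_succ, <- IH).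
      generalize (trajectory w C (i + m)). intros; z2eq.
    - set (v' := addZ2 v (smul (-1) (dir_vec (heading (ant_iter w (S (i + l)) C))))).
      replace (i + S l)%nat with (S (i + l)) in * by lia.
      assert (Hv' : trajectory w C (i + l) = addZ2 (trajectory w C i) v').
      { rewrite pos_turn in Hv. unfold v', smul. revert Hv.
        generalize (trajectory w C (i + l)), (trajectory w C i),
          (dir_vec (heading (ant_iter w (S (i + l)) C))).
        intros; z2. injection Hv as H1 H2. f_equal; lia. }
      cbn [Nat.add]. rewrite pos_turn, (IH v' Hv').
      change (S (i + l + m)) with (S (i + l) + m)%nat. rewrite Hh, dir_vec_rot.
      replace v with (addZ2 v' (dir_vec (heading (ant_iter w (S (i + l)) C)))).
      2:{ unfold v', smul. generalize (dir_vec (heading (ant_iter w (S (i + l)) C))).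
          intros; z2eq. }
      rewrite rotv_add.
      generalize (trajectory w C (i + m)) (Nat.iter j rotv v')
        (Nat.iter j rotv (dir_vec (heading (ant_iter w (S (i + l)) C)))).
      intros; z2eq. }
  assert (Hex : forall i l, exists v, trajectory w C (i + l) = addZ2 (trajectory w C i) v).
  { intros i l. exists (addZ2 (trajectory w C (i + l)) (smul (-1) (trajectory w C i))).
    unfold smul. generalize (trajectory w C (i + l)) (trajectory w C i). intros; z2eq. }
  destruct (Nat.eq_dec j 0) as [->|Hj1].
  - destruct (Hex 0%nat m) as [v Hv]. exists v. intros i. split; [apply Hper|].
    destruct (Hex 0%nat i) as [v' Hv'].
    pose proof (Hdisp _ _ _ Hv') as H. cbn [Nat.add Nat.iter nat_rect] in H, Hv, Hv'.
    rewrite H, Hv, Hv'. generalize (trajectory w C 0). intros; z2eq.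
  - exfalso. apply Hd.
    (* For [j] from 1 to 3 the four successive rotations of [v] add up to zero. *)
    assert (H4 : forall i, trajectory w C (i + 4 * m) = trajectory w C i).
    { intros i. destruct (Hex i m) as [v Hv].
      pose proof (Hdisp _ _ _ Hv) as Hv1.
      pose proof (Hdisp _ _ _ Hv1) as Hv2.
      pose proof (Hdisp _ _ _ Hv2) as Hv3.
      replace (i + 4 * m)%nat with (i + m + m + m + m)%nat by lia.
      rewrite Hv3, Hv2, Hv1, Hv. generalize (trajectory w C i). intros p.
      destruct p as [px py], v as [vx vy].
      destruct j as [|[|[|[|]]]]; try lia; cbn; unfold rotv, addZ2; cbn; f_equal; ring. }
    assert (H4n : forall k i, trajectory w C (i + k * (4 * m)) = trajectory w C i).
    { induction k as [|k IH]; intros i; [cbn; f_equal; lia|].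
      replace (i + S k * (4 * m))%nat with (i + k * (4 * m) + 4 * m)%nat by lia.
      now rewrite H4, IH. }
    (* [4 * m * n] steps are a whole number of these returns, yet they drift by [4 * m] times
       [d]. *)
    pose proof (H4n n 0%nat) as Ha. pose proof (drift_iter _ _ _ _ Hdr (4 * m)%nat 0%nat) as Hb.
    replace (0 + 4 * m * n)%nat with (0 + n * (4 * m))%nat in Hb by lia.
    rewrite Ha in Hb. revert Hb. unfold smul. generalize (trajectory w C 0).
    intros; z2. injection Hb as H1 H2. f_equal; nia.
Qed.

(** Classical, as it is applied to the periods of an infinite trace. *)
Lemma least_nat (P : nat -> Prop) n : P n -> exists m, P m /\ forall k, (k < m)%nat -> ~ P k.
Proof.
  intros Hn. destruct (Classical_Prop.classic (exists m, P m /\ forall k, (k < m)%nat -> ~ P k))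
    as [H|H]; [assumption|exfalso].
  assert (Hall : forall m k, (k < m)%nat -> ~ P k).
  { induction m as [|m IH]; intros k Hk HP; [lia|].
    destruct (Nat.eq_dec k m) as [->|]; [|apply (IH k); auto; lia].
    apply H. exists m. auto. }
  exact (Hall (S n) n (Nat.lt_succ_diag_r n) Hn).
Qed.

(** [is_highway] asks for the least period, which the simulations do not determine. The least period
    has a drift of its own, and comparing both drifts over [m * n] steps shows that it is
    proportional to [d]; its direction decides whether the highway is diagonal. *)
Lemma drifts_highway w C n d :
  finite_config w C -> (0 < n)%nat -> drifts w C n d -> d <> (0, 0) ->
  exists m a b, is_highway w C m a b /\
    a * Z.of_nat n = fst d * Z.of_nat m /\ b * Z.of_nat n = snd d * Z.of_nat m /\ (0 < m)%nat.
Proof.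
  intros HC Hn Hdr Hd.
  destruct (least_nat (fun m => (0 < m)%nat /\ forall i, trace w C (i + m) = trace w C i) n)
    as (m & [Hm Hper] & Hmin).
  { split; [assumption|]. intros i. apply Hdr. }
  destruct (trace_period_drifts w C n d m Hdr Hd Hm Hper) as [[a b] Hdm].
  exists m, a, b. split; [|].
  - split; [assumption|split; [assumption|split; [assumption|split]]].
    + intros k Hk Hk'. apply (Hmin k); [lia|]. split; [lia|assumption].
    + intros i. apply Hdm.
  - pose proof (drift_iter _ _ _ _ Hdr m 0%nat) as H1.
    pose proof (drift_iter _ _ _ _ Hdm n 0%nat) as H2.
    rewrite (Nat.mul_comm n m), H1 in H2. revert H2. unfold smul. generalize (trajectory w C 0).
    intros; z2. injection H2 as H3 H4. repeat split; lia.
Qed.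

(** Over [n1 * n2] steps the two trajectories advance by [n2] and [n1] times [d], and equivalence
    makes these equal. The periods compared are those of a common drift, so least periods need not
    be known. *)
Lemma highway_equiv_period w C1 C2 n1 n2 d :
  drifts w C1 n1 d -> drifts w C2 n2 d -> d <> (0, 0) -> highway_equiv w C1 C2 -> n1 = n2.
Proof.
  intros H1 H2 Hd (m1 & m2 & t & H).
  pose proof (proj2 (H 0%nat)) as Ha. pose proof (proj2 (H (n1 * n2)%nat)) as Hb.
  rewrite (Nat.mul_comm n1 n2) in Hb at 1.
  rewrite !Nat.add_0_r in Ha.
  rewrite (drift_iter _ _ _ _ H1), (drift_iter _ _ _ _ H2), Ha in Hb.
  revert Hb. unfold smul. generalize (trajectory w C2 m2). intros; z2.
  injection Hb as Hx Hy.
  destruct (Nat.eq_dec n1 n2) as [|Hne]; [assumption|exfalso; apply Hd; f_equal; nia].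
Qed.

(** * Finite checks *)

Definition digits (s : String.string) : list nat :=
  map (fun c => (Ascii.nat_of_ascii c - 48)%nat) (String.list_ascii_of_string s).

(** Rows are drawn from top to bottom, whereas row 0 of a table is the lowest one. *)
Definition picture (rows : list String.string) : list (list nat) := rev (map digits rows).

Definition zrange (a : Z) (n : nat) : list Z := map (fun i => a + Z.of_nat i) (seq 0 n).

Lemma in_zrange a n x : a <= x < a + Z.of_nat n -> In x (zrange a n).
Proof.
  intros H. apply in_map_iff. exists (Z.to_nat (x - a)). split; [lia|].
  apply in_seq. lia.
Qed.

Definition box_forallb (a b : Z) (W H : nat) (f : Z * Z -> bool) : bool :=
  forallb (fun y => forallb (fun x => f (x, y)) (zrange a W)) (zrange b H).

Lemma box_forallb_spec a b W H f : box_forallb a b W H f = true ->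
  forall x y, a <= x < a + Z.of_nat W -> b <= y < b + Z.of_nat H -> f (x, y) = true.
Proof.
  intros Hf x y Hx Hy. unfold box_forallb in Hf. rewrite forallb_forall in Hf.
  specialize (Hf y (in_zrange _ _ _ Hy)). rewrite forallb_forall in Hf.
  exact (Hf x (in_zrange _ _ _ Hx)).
Qed.

Definition fits (t : list (list nat)) (W H : nat) : bool :=
  (length t <=? H)%nat && forallb (fun r => (length r <=? W)%nat) t.

Lemma look_outside t W H x y : fits t W H = true ->
  ~ (0 <= x < Z.of_nat W /\ 0 <= y < Z.of_nat H) -> look t (x, y) = 0%nat.
Proof.
  unfold fits, look. cbn [fst snd]. rewrite andb_true_iff, forallb_forall, Nat.leb_le.
  intros [HH HW] Hout.
  destruct (Z.ltb_spec x 0); [reflexivity|]. destruct (Z.ltb_spec y 0); [reflexivity|].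
  cbn [orb].
  destruct (Nat.lt_ge_cases (Z.to_nat y) (length t)) as [Hy|Hy].
  - apply nth_overflow.
    pose proof (HW _ (nth_In t [] Hy)) as Hr. rewrite Nat.leb_le in Hr. lia.
  - rewrite (nth_overflow t) by assumption. now destruct (Z.to_nat x).
Qed.

(* Beyond a margin of width [m] around the boxes both tables are 0 at the compared cells,
   so a finite check suffices. *)
Definition shift_check (Q : Z * Z -> bool) (d : Z * Z) (t t' : list (list nat)) : bool :=
  let W := Nat.max (list_max (map (@length nat) t)) (list_max (map (@length nat) t')) in
  let H := Nat.max (length t) (length t') in
  let m := Z.max (Z.abs (fst d)) (Z.abs (snd d)) in
  box_forallb (- m) (- m) (W + 2 * Z.to_nat m) (H + 2 * Z.to_nat m)
    (fun p => negb (Q p) || (look t' (addZ2 p d) =? look t p)%nat).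

Lemma fits_max t : forall W H,
  (list_max (map (@length nat) t) <= W)%nat -> (length t <= H)%nat ->
  fits t W H = true.
Proof.
  intros W H HW HH. unfold fits. apply andb_true_iff. split; [now apply Nat.leb_le|].
  apply forallb_forall. intros r Hr. apply Nat.leb_le.
  apply list_max_le in HW. rewrite Forall_forall in HW. apply HW.
  now apply in_map.
Qed.

Lemma shift_check_spec Q d t t' : shift_check Q d t t' = true ->
  forall p, Q p = true -> look t' (addZ2 p d) = look t p.
Proof.
  unfold shift_check.
  set (W := Nat.max _ _). set (H := Nat.max _ _). set (m := Z.max _ _).
  intros Hc [x y] HQ.
  destruct (Z_le_dec (- m) x) as [Hx1|Hx1]; [destruct (Z_lt_dec x (Z.of_nat W + m)) as [Hx2|Hx2];
   [destruct (Z_le_dec (- m) y) as [Hy1|Hy1]; [destruct (Z_lt_dec y (Z.of_nat H + m)) as [Hy2|Hy2]|]|]|].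
  1:{ assert (Hf := box_forallb_spec _ _ _ _ _ Hc x y ltac:(lia) ltac:(lia)).
      cbv beta in Hf. rewrite HQ in Hf. cbn [negb orb] in Hf. now apply Nat.eqb_eq. }
  all: unfold addZ2; cbn [fst snd];
    rewrite (look_outside t W H) by (try (apply fits_max; unfold W, H; lia); lia);
    apply (look_outside t' W H); [apply fits_max; unfold W, H; lia|lia].
Qed.

Definition den (s : tconfig) : ant_config := mkConfig (look (tab s)) (tpos s) (thead s).

Definition small_states (k : nat) (t : list (list nat)) : bool :=
  forallb (forallb (fun v => (v <? k)%nat)) t.

Lemma small_states_look k t p : (0 < k)%nat -> small_states k t = true -> (look t p < k)%nat.
Proof.
  intros Hk Ht. destruct p as [x y]. unfold look. destruct (_ || _); [assumption|].
  unfold small_states in Ht. rewrite forallb_forall in Ht. cbn [fst snd].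
  destruct (nth_in_or_default (Z.to_nat y) t []) as [Hin|Hd].
  - specialize (Ht _ Hin). rewrite forallb_forall in Ht.
    destruct (nth_in_or_default (Z.to_nat x) (nth (Z.to_nat y) t []) 0%nat) as [Hin'|Hd'].
    + apply Nat.ltb_lt. now apply Ht.
    + now rewrite Hd'.
  - rewrite Hd. now destruct (Z.to_nat x).
Qed.

Lemma finite_of_box w C (a b : Z) (W H : nat) :
  valid_config w C ->
  (forall x y, ~ (a <= x < a + Z.of_nat W /\ b <= y < b + Z.of_nat H) -> cells C (x, y) = 0%nat) ->
  finite_config w C.
Proof.
  intros HV Hout. split; [assumption|].
  exists (list_prod (zrange a W) (zrange b H)). intros [x y] Hnin. apply Hout.
  intros [Hx Hy]. apply Hnin. apply in_prod; now apply in_zrange.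
Qed.

Lemma den_finite w s :
  (0 < length w)%nat -> small_states (length w) (tab s) = true ->
  finite_config w (den s).
Proof.
  intros Hw Hs.
  apply (finite_of_box w (den s) 0 0 (list_max (map (@length nat) (tab s)))
           (length (tab s))).
  - intros p. now apply small_states_look.
  - intros x y Hout. cbn [den cells].
    apply (look_outside _ (list_max (map (@length nat) (tab s))) (length (tab s)));
      [apply fits_max; lia|lia].
Qed.

Lemma den_docked s : docked (den s) s (0, 0).
Proof. split; cbn; [destruct (tpos s); z2eq|reflexivity]. Qed.

Lemma den_matches Q s : matches Q (den s) s (0, 0).
Proof. intros [x y] _. cbn. unfold addZ2. cbn. now rewrite !Z.add_0_r. Qed.

Definition dir_eqb (q q' : dir) : bool :=
  match q, q' with
  | DN, DN | DE, DE | DS, DS | DW, DW => true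
  | _, _ => false
  end.

Lemma dir_eqb_eq q q' : dir_eqb q q' = true -> q = q'.
Proof. now destruct q, q'. Qed.

Definition Z2_eqb (p q : Z * Z) : bool := (fst p =? fst q) && (snd p =? snd q).

Definition moved_by (d : Z * Z) (s s' : tconfig) : bool :=
  Z2_eqb (tpos s') (addZ2 (tpos s) d) && dir_eqb (thead s') (thead s).

Lemma moved_by_spec d s s' : moved_by d s s' = true ->
  tpos s' = addZ2 (tpos s) d /\ thead s' = thead s.
Proof.
  unfold moved_by. rewrite andb_true_iff. intros [H1 H2].
  split; [now apply Z2_eqb_spec|now apply dir_eqb_eq].
Qed.

(** A frame clause of [trun_sound], instantiated at [den s], which realises the table. *)
Lemma trun_frame w Q n s tr s' : trun w Q n s = Some (tr, s') ->
  forall p, Q p = false -> look (tab s') p = look (tab s) p.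
Proof.
  intros H. destruct (trun_sound w Q n s (den s) (0, 0) tr s' H) as (? & _ & _ & _ & _ & _ & Hf);
    auto using den_docked, den_matches.
Qed.

Lemma trun_length w Q n s tr s' : trun w Q n s = Some (tr, s') -> length tr = n.
Proof.
  intros H. destruct (trun_sound w Q n s (den s) (0, 0) tr s' H) as (? & _ & Hl & _);
    auto using den_docked, den_matches.
Qed.

Lemma addZ2_0_r p : addZ2 p (0, 0) = p.
Proof. z2eq. Qed.

Definition drift_check (w : list letter) (R : Z * Z -> bool) (n : nat) (d : Z * Z)
    (s : tconfig) : bool :=
  match trun w R n s with
  | Some (_, s') => moved_by d s s' && shift_check R d (tab s) (tab s')
  | None => false
  end.

(** A single simulated period feeds [drifts_of_translate]: its guard shows that the ant stays in
    [R], and [shift_check] compares the cells of [R] with their translates. *)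
Lemma table_drifts w R n d s : (0 < n)%nat ->
  drift_check w R n d s = true ->
  (forall p, R p = true -> R (addZ2 p d) = true) ->
  drifts w (den s) n d.
Proof.
  intros Hn Hc HR. unfold drift_check in Hc.
  destruct (trun w R n s) as [[tr s']|] eqn:Hr; [|discriminate].
  apply andb_true_iff in Hc. destruct Hc as [Hm Hs]. apply moved_by_spec in Hm.
  destruct Hm as [Hp Hh].
  destruct (trun_sound w R n s (den s) (0, 0) tr s' Hr (den_docked s) (den_matches R s))
    as (E' & [HE HV] & Hl & [Hp' Hh'] & Hma & _ & _).
  rewrite Hl in *. subst E'.
  apply (drifts_of_translate w _ n d (fun p => R p = true)); auto.
  - intros i Hi. destruct (HV i Hi) as [_ (q & Hq & ->)]. now rewrite addZ2_0_r.
  - rewrite Hp', Hp. cbn [den pos]. now rewrite addZ2_0_r.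
  - rewrite Hh', Hh. reflexivity.
  - intros p Hp0. rewrite <- (addZ2_0_r (addZ2 p d)), Hma by auto.
    now apply (shift_check_spec R).
Qed.

(** * The vertical highway *)

(** The two lowest rows are room for one period, since a simulation cannot leave the stored
    cells. *)
Definition table_vertical : list (list nat) :=
  picture ([
    "205552255554151";
    "153330044442531";
    "130002432220210";
    "012444423553100";
    "001111111111000";
    "000000000000000";
    "000000000000000" ])%string.

Definition start_vertical : tconfig := mkT table_vertical (10, 6) DS.

Lemma vertical_drifts : drifts w_LLRRRL (den start_vertical) 300 (0, -2).
Proof.
  (* The half plane ends at the top row of the table and is mapped into itself by the drift. *)
  apply (table_drifts _ (fun p => snd p <=? 6)); [lia|vm_compute; reflexivity|].
  intros [x y]. unfold addZ2. cbn [fst snd]. rewrite !Z.leb_le. lia.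
Qed.

Lemma vertical_highway : exists (C : ant_config) (n : nat) (a b : Z),
  is_highway w_LLRRRL C n a b /\ ~ diagonal_drift a b.
Proof.
  destruct (drifts_highway w_LLRRRL (den start_vertical) 300 (0, -2)) as (m & a & b & H & Ha & Hb & Hm).
  - apply den_finite; vm_compute; [lia|reflexivity].
  - lia.
  - apply vertical_drifts.
  - discriminate.
  - exists (den start_vertical), m, a, b. split; [assumption|].
    (* Proportionality gives [a = 0] and [b < 0]. *)
    cbn [fst snd] in Ha, Hb. unfold diagonal_drift. lia.
Qed.

(** * Diagonal highways of arbitrary width *)

(** [e] is the first column of the repeated block. Columns before it stay in place and those after
    it move by [2 * (K - 1)], so [K = 1] gives back the table. *)
Definition stretched (e : Z) (K : nat) (E : ant_config) (s : tconfig) : Prop :=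
  matches (fun p => fst p <? e) E s (0, 0) /\
  (forall j, 0 <= j < Z.of_nat K ->
     matches (fun p => (e <=? fst p) && (fst p <? e + 2)) E s (2 * j, 0)) /\
  matches (fun p => e + 2 <=? fst p) E s (2 * (Z.of_nat K - 1), 0).

Definition upper (p : Z * Z) : bool := (0 <=? fst p) && (10 <=? snd p).

(** Both parts are stable under the drift [(4, 4)], which preserves [fst p - snd p]. In [ahead_wide]
    the slanted part moves right together with the columns behind the strip. *)
Definition ahead (p : Z * Z) : bool :=
  upper p || ((1 <=? snd p) && (11 <=? fst p - snd p)).

Definition ahead_wide (K : nat) (p : Z * Z) : Prop :=
  (0 <= fst p /\ 10 <= snd p) \/
  (1 <= snd p /\ 11 <= fst p - 2 * (Z.of_nat K - 1) - snd p).

Ltac boolz := repeat rewrite ?andb_true_iff, ?orb_true_iff, ?negb_true_iff, ?andb_false_iff,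
  ?orb_false_iff, ?negb_false_iff, ?Z.leb_le, ?Z.ltb_lt, ?Z.leb_gt, ?Z.ltb_ge in *.

(** Right of the strip the ant sees the table displaced by [2 * (K - 1)]; the strip and everything
    left of it remain unchanged, in the table as in the plane. *)
Lemma run_right w e (K : nat) E s n tr s' : (1 <= K)%nat ->
  stretched e K E s -> docked E s (2 * (Z.of_nat K - 1), 0) ->
  trun w (fun p => (e + 2 <=? fst p) && ahead p) n s = Some (tr, s') ->
  exists E', runs w (ahead_wide K) E tr E' /\ stretched e K E' s' /\
    docked E' s' (2 * (Z.of_nat K - 1), 0).
Proof.
  intros HK (HL & HB & HR) Hd Hr.
  pose proof (trun_frame _ _ _ _ _ _ Hr) as Hf.
  destruct (trun_sound _ _ _ _ _ _ _ _ Hr Hd) as (E' & Hrun & _ & Hd' & Hm & Hfr & _).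
  { intros p Hp. apply HR. now apply andb_true_iff in Hp. }
  exists E'. split; [|split; [|assumption]].
  - eapply runs_weaken; [|exact Hrun]. cbv beta. intros p ([x y] & Hq & ->).
    unfold ahead_wide, ahead, upper, addZ2 in *. cbn [fst snd] in *. boolz. lia.
  - assert (Hpass : forall p, fst p < e + 2 * Z.of_nat K -> cells E' p = cells E p).
    { intros p Hp. apply Hfr. intros [x y] Hq ->. unfold addZ2 in Hp. cbn [fst snd] in *. boolz. lia. }
    split; [|split].
    + intros [x y] Hp. rewrite Hpass, HL, Hf; auto; unfold addZ2; cbn [fst snd] in *; boolz; lia.
    + intros j Hj [x y] Hp.
      rewrite Hpass, (HB j), Hf; auto; unfold addZ2; cbn [fst snd] in *; boolz; lia.
    + intros p Hp. destruct (ahead p) eqn:Ha.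
      * apply Hm. now rewrite Hp, Ha.
      * rewrite Hfr, HR, Hf; auto.
        -- now rewrite Ha, andb_false_r.
        -- intros q Hq Heq. apply addZ2_inj_r in Heq. subst. rewrite Ha, andb_false_r in Hq.
           discriminate.
Qed.

Lemma run_left w e (K : nat) E s n tr s' : (1 <= K)%nat ->
  stretched e K E s -> docked E s (0, 0) ->
  trun w (fun p => (fst p <? e) && upper p) n s = Some (tr, s') ->
  exists E', runs w (ahead_wide K) E tr E' /\ stretched e K E' s' /\ docked E' s' (0, 0).
Proof.
  intros HK (HL & HB & HR) Hd Hr.
  pose proof (trun_frame _ _ _ _ _ _ Hr) as Hf.
  destruct (trun_sound _ _ _ _ _ _ _ _ Hr Hd) as (E' & Hrun & _ & Hd' & Hm & Hfr & _).
  { intros p Hp. apply HL. now apply andb_true_iff in Hp. }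
  exists E'. split; [|split; [|assumption]].
  - eapply runs_weaken; [|exact Hrun]. cbv beta. intros p ([x y] & Hq & ->).
    unfold ahead_wide, upper, addZ2 in *. cbn [fst snd] in *. boolz. lia.
  - assert (Hpass : forall p, e <= fst p -> cells E' p = cells E p).
    { intros p Hp. apply Hfr. intros [x y] Hq ->. unfold addZ2 in Hp. cbn [fst snd] in *. boolz. lia. }
    split; [|split].
    + intros p Hp. destruct (upper p) eqn:Ha.
      * apply Hm. now rewrite Hp, Ha.
      * rewrite Hfr, HL, Hf; auto.
        -- now rewrite Ha, andb_false_r.
        -- intros q Hq Heq. apply addZ2_inj_r in Heq. subst. rewrite Ha, andb_false_r in Hq.
           discriminate.
    + intros j Hj [x y] Hp.
      rewrite Hpass, (HB j), Hf; auto; unfold addZ2; cbn [fst snd] in *; boolz; lia.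
    + intros [x y] Hp. rewrite Hpass, HR, Hf; auto; unfold addZ2; cbn [fst snd] in *; boolz; lia.
Qed.

(** The [v] columns right of the strip are the window of [sweep_sound]. Once they have been carried
    to its left end, the strip begins [v] columns further right in the table, hence [e + v]. *)
Lemma sweep_left w e v (K : nat) E s n tr s' : (1 <= K)%nat -> 0 <= v ->
  stretched e K E s -> docked E s (2 * (Z.of_nat K - 1), 0) ->
  trun w (fun p => (e <=? fst p) && (fst p <? e + 2 + v) && upper p) n s = Some (tr, s') ->
  moved_by (-2, 0) s s' = true ->
  shift_check (fun p => (e + 2 <=? fst p) && (fst p <? e + 2 + v)) (-2, 0) (tab s) (tab s') = true ->
  exists E', runs w (ahead_wide K) E (concat (repeat tr K)) E' /\ stretched (e + v) K E' s' /\
    docked E' s' (0, 0).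
Proof.
  intros HK Hv (HL & HB & HR) Hd Hr Hmv Hsc.
  apply moved_by_spec in Hmv. destruct Hmv as [Hp Hh].
  pose proof (shift_check_spec _ _ _ _ Hsc) as Hsh.
  pose proof (trun_frame _ _ _ _ _ _ Hr) as Hf.
  destruct (sweep_sound w _ (fun p => (e + 2 <=? fst p) && (fst p <? e + 2 + v))
     (fun p => (e <=? fst p) && (fst p <? e + 2)) (-2, 0) (2 * (Z.of_nat K - 1), 0)
     n s s' tr K E Hr Hp Hh) as (E' & Hrun & Hd' & HmW & HmA & Hfr & _).
  - intros [x y]. cbn [fst snd]. boolz. lia.
  - intros [x y] Hw. split; [|now apply Hsh]. unfold addZ2. cbn [fst snd] in *. boolz. lia.
  - intros [x y] j Hj. unfold addZ2, smul. cbn [fst snd]. boolz. lia.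
  - intros [x y] j Hj. unfold addZ2, smul. cbn [fst snd]. boolz. lia.
  - assumption.
  - intros [x y] Hw. apply HR. cbn [fst snd] in *. boolz. lia.
  (* The blocks are met from right to left: block [j] of the sweep is number [K - 1 - j] of the
     strip. *)
  - intros j Hj. replace (addZ2 (2 * (Z.of_nat K - 1), 0) (smul j (-2, 0)))
      with (2 * (Z.of_nat K - 1 - j), 0) by (unfold smul; z2eq).
    apply HB. lia.
  - exists E'. split; [|split; [split; [|split]|]].
    + eapply runs_weaken; [|exact Hrun]. cbv beta. intros p (j & [x y] & Hj & Hq & ->).
      unfold ahead_wide, upper, addZ2, smul in *. cbn [fst snd] in *. boolz. lia.
    + intros [x y] Hx. cbn [fst snd] in Hx. boolz.
      destruct (Z_lt_dec x e) as [Hlt|Hge].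
      * rewrite Hfr, HL, Hf; auto; [cbn [fst snd]; boolz; lia|cbn [fst snd]; boolz; lia|].
        intros j [x' y'] Hj Hq. unfold addZ2, smul. cbn [fst snd] in *. boolz. intros Heq; apply pair_equal_spec in Heq; lia.
      (* These columns hold the window after its last displacement; [Hsh] locates it in the final
         table. *)
      * specialize (HmW (x + 2, y)). specialize (Hsh (x + 2, y)). cbn [fst snd] in HmW, Hsh.
        unfold addZ2, smul in *. cbn [fst snd] in *.
        replace (x + 2 + -2) with x in Hsh by ring. rewrite !Z.add_0_r in *.
        replace (x + 2 + (2 * (Z.of_nat K - 1) + Z.of_nat K * -2)) with x in HmW by ring.
        replace (y + (0 + Z.of_nat K * 0)) with y in HmW by ring.
        rewrite HmW, <- Hsh; [reflexivity| |]; boolz; lia.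
    + intros j Hj p Hx.
      replace (2 * j, 0) with
        (addZ2 (2 * (Z.of_nat K - 1), 0) (smul (Z.of_nat K - 1 - j) (-2, 0))) by (unfold smul; z2eq).
      apply HmA; [lia|]. destruct p as [x y]. unfold addZ2, smul. cbn [fst snd] in *. boolz. lia.
    + intros [x y] Hx. cbn [fst snd] in Hx. boolz.
      rewrite Hfr, HR, Hf; auto; [cbn [fst snd]; boolz; lia|cbn [fst snd]; boolz; lia|].
      intros j [x' y'] Hj Hq. unfold addZ2, smul. cbn [fst snd] in *. boolz. intros Heq; apply pair_equal_spec in Heq; lia.
    + destruct Hd' as [Hp' Hh']. split; [|congruence].
      rewrite Hp', Hp. unfold smul. z2eq.
Qed.

(** Mirror image of [sweep_left]: the window comes from the left, so the strip moves back to
    [e - v]. *)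
Lemma sweep_right w e v (K : nat) E s n tr s' : (1 <= K)%nat -> 0 <= v ->
  stretched e K E s -> docked E s (0, 0) ->
  trun w (fun p => (e - v <=? fst p) && (fst p <? e + 2) && upper p) n s = Some (tr, s') ->
  moved_by (2, 0) s s' = true ->
  shift_check (fun p => (e - v <=? fst p) && (fst p <? e)) (2, 0) (tab s) (tab s') = true ->
  exists E', runs w (ahead_wide K) E (concat (repeat tr K)) E' /\ stretched (e - v) K E' s' /\
    docked E' s' (2 * (Z.of_nat K - 1), 0).
Proof.
  intros HK Hv (HL & HB & HR) Hd Hr Hmv Hsc.
  apply moved_by_spec in Hmv. destruct Hmv as [Hp Hh].
  pose proof (shift_check_spec _ _ _ _ Hsc) as Hsh.
  pose proof (trun_frame _ _ _ _ _ _ Hr) as Hf.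
  destruct (sweep_sound w _ (fun p => (e - v <=? fst p) && (fst p <? e))
     (fun p => (e <=? fst p) && (fst p <? e + 2)) (2, 0) (0, 0)
     n s s' tr K E Hr Hp Hh) as (E' & Hrun & Hd' & HmW & HmA & Hfr & _).
  - intros [x y]. cbn [fst snd]. boolz. lia.
  - intros [x y] Hw. split; [|now apply Hsh]. unfold addZ2. cbn [fst snd] in *. boolz. lia.
  - intros [x y] j Hj. unfold addZ2, smul. cbn [fst snd]. boolz. lia.
  - intros [x y] j Hj. unfold addZ2, smul. cbn [fst snd]. boolz. lia.
  - assumption.
  - intros [x y] Hw. apply HL. cbn [fst snd] in *. boolz. lia.
  - intros j Hj. replace (addZ2 (0, 0) (smul j (2, 0))) with (2 * j, 0) by (unfold smul; z2eq).
    apply HB. lia.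
  - exists E'. split; [|split; [split; [|split]|]].
    + eapply runs_weaken; [|exact Hrun]. cbv beta. intros p (j & [x y] & Hj & Hq & ->).
      unfold ahead_wide, upper, addZ2, smul in *. cbn [fst snd] in *. boolz. lia.
    + intros [x y] Hx. cbn [fst snd] in Hx. boolz.
      rewrite Hfr, HL, Hf; auto; [cbn [fst snd]; boolz; lia|cbn [fst snd]; boolz; lia|].
      intros j [x' y'] Hj Hq. unfold addZ2, smul. cbn [fst snd] in *. boolz. intros Heq; apply pair_equal_spec in Heq; lia.
    + intros j Hj p Hx.
      replace (2 * j, 0) with (addZ2 (0, 0) (smul j (2, 0))) by (unfold smul; z2eq).
      apply HmA; [lia|]. destruct p as [x y]. unfold addZ2, smul. cbn [fst snd] in *. boolz. lia.
    + intros [x y] Hx. cbn [fst snd] in Hx. boolz.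
      destruct (Z_lt_dec x (e + 2)) as [Hlt|Hge].
      * specialize (HmW (x - 2, y)). specialize (Hsh (x - 2, y)). cbn [fst snd] in HmW, Hsh.
        unfold addZ2, smul in *. cbn [fst snd] in *.
        replace (x - 2 + 2) with x in Hsh by ring. rewrite !Z.add_0_r in *.
        replace (x - 2 + (0 + Z.of_nat K * 2)) with (x + 2 * (Z.of_nat K - 1)) in HmW by ring.
        replace (y + (0 + Z.of_nat K * 0)) with y in HmW by ring.
        rewrite HmW, <- Hsh; [reflexivity| |]; boolz; lia.
      * rewrite Hfr, HR, Hf; auto; [cbn [fst snd]; boolz; lia|cbn [fst snd]; boolz; lia|].
        intros j [x' y'] Hj Hq. unfold addZ2, smul. cbn [fst snd] in *. boolz. intros Heq; apply pair_equal_spec in Heq; lia.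
    + destruct Hd' as [Hp' Hh']. split; [|congruence].
      rewrite Hp', Hp. unfold smul. z2eq.
Qed.

(* A round runs on the right of the strip, sweeps it leftwards with a window of width [v1],
   runs on the left of the strip and sweeps it back with a window of width [v2]. *)
Definition round : Type := (nat * nat * Z * (nat * nat * Z))%type.

Definition right_of (e : Z) (p : Z * Z) : bool := (e + 2 <=? fst p) && ahead p.
Definition left_of (e : Z) (p : Z * Z) : bool := (fst p <? e) && upper p.

(* Returns the number of steps spent outside the sweeps and the number of steps spent
   sweeping one block. *)
Fixpoint rounds (w : list letter) (ops : list round) (e : Z) (s : tconfig)
    : option (nat * nat * Z * tconfig) :=
  match ops with
  | [] => Some (0%nat, 0%nat, e, s)
  | (r1, n1, v1, (r2, n2, v2)) :: ops' =>
    match trun w (right_of e) r1 s with None => None | Some (_, s1) =>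
    match trun w (fun p => (e <=? fst p) && (fst p <? e + 2 + v1) && upper p) n1 s1 with
    | None => None | Some (_, s2) =>
    if (0 <=? v1) && moved_by (-2, 0) s1 s2 &&
       shift_check (fun p => (e + 2 <=? fst p) && (fst p <? e + 2 + v1)) (-2, 0) (tab s1) (tab s2)
    then
    match trun w (left_of (e + v1)) r2 s2 with None => None | Some (_, s3) =>
    match trun w (fun p => (e + v1 - v2 <=? fst p) && (fst p <? e + v1 + 2) && upper p) n2 s3 with
    | None => None | Some (_, s4) =>
    if (0 <=? v2) && moved_by (2, 0) s3 s4 &&
       shift_check (fun p => (e + v1 - v2 <=? fst p) && (fst p <? e + v1)) (2, 0) (tab s3) (tab s4)
    then
    match rounds w ops' (e + v1 - v2) s4 with
    | Some (a, b, e', s') => Some ((r1 + r2 + a)%nat, (n1 + n2 + b)%nat, e', s')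
    | None => None
    end
    else None end end
    else None end end
  end.

(** One computation on the unstretched table covers every [K]: each sweep is repeated [K] times, so
    the length is affine in [K]. *)
Lemma rounds_sound w ops : forall e s a b e' s' (K : nat) E,
  rounds w ops e s = Some (a, b, e', s') -> (1 <= K)%nat ->
  stretched e K E s -> docked E s (2 * (Z.of_nat K - 1), 0) ->
  exists tr E', runs w (ahead_wide K) E tr E' /\ length tr = (a + K * b)%nat /\
    stretched e' K E' s' /\ docked E' s' (2 * (Z.of_nat K - 1), 0).
Proof.
  induction ops as [|[[[r1 n1] v1] [[r2 n2] v2]] ops IH]; cbn [rounds];
    intros e s a b e' s' K E H HK HS HD.
  - injection H as <- <- <- <-. exists [], E. split; [apply runs_nil|]. cbn. repeat split; auto; try lia.
    all: apply HS || apply HD.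
  - destruct (trun w (right_of e) r1 s) as [[tr1 s1]|] eqn:H1; [|discriminate].
    destruct (trun w _ n1 s1) as [[tr2 s2]|] eqn:H2; [|discriminate].
    destruct (_ && _) eqn:C1 in H; [|discriminate].
    destruct (trun w _ r2 s2) as [[tr3 s3]|] eqn:H3; [|discriminate].
    destruct (trun w _ n2 s3) as [[tr4 s4]|] eqn:H4; [|discriminate].
    destruct (_ && _) eqn:C2 in H; [|discriminate].
    destruct (rounds w ops _ s4) as [[[[a' b'] e1] s5]|] eqn:H5; [|discriminate].
    injection H as <- <- <- <-.
    rewrite !andb_true_iff, Z.leb_le in C1, C2.
    destruct C1 as [[Cv1 Cm1] Cs1], C2 as [[Cv2 Cm2] Cs2].
    destruct (run_right w e K E s r1 tr1 s1 HK HS HD H1) as (E1 & R1 & S1 & D1).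
    destruct (sweep_left w e v1 K E1 s1 n1 tr2 s2 HK Cv1 S1 D1 H2 Cm1 Cs1) as (E2 & R2 & S2 & D2).
    destruct (run_left w (e + v1) K E2 s2 r2 tr3 s3 HK S2 D2 H3) as (E3 & R3 & S3 & D3).
    destruct (sweep_right w (e + v1) v2 K E3 s3 n2 tr4 s4 HK Cv2 S3 D3 H4 Cm2 Cs2)
      as (E4 & R4 & S4 & D4).
    destruct (IH _ _ _ _ _ _ K E4 H5 HK S4 D4) as (tr5 & E5 & R5 & L5 & S5 & D5).
    exists (tr1 ++ concat (repeat tr2 K) ++ tr3 ++ concat (repeat tr4 K) ++ tr5), E5.
    split; [|split; [|split; assumption]].
    + eauto using runs_app.
    + rewrite !length_app, !length_concat_repeat, L5.
      rewrite (trun_length _ _ _ _ _ _ H1), (trun_length _ _ _ _ _ _ H2),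
        (trun_length _ _ _ _ _ _ H3), (trun_length _ _ _ _ _ _ H4). lia.
Qed.

Definition table_diagonal : list (list nat) :=
  picture ([
    "000000000000000000000000000000";
    "000000000000000000000000000000";
    "000000000000000000000000000000";
    "000000000000000000000000000000";
    "000000000000000000000011110000";
    "011222222222222221111124410000";
    "135000000000000004444441020000";
    "424444444444444432222232520000";
    "300000000000001544444542300000";
    "000000000000010555555420300000";
    "000000000000000000005200300000";
    "000000000000000000050400300000";
    "000000000000000000010414200000";
    "000000000000000002021102000000";
    "000000000000000013242202000000";
    "000000000000000134550202000000";
    "000000000000002043204151000000";
    "000000000000022101450531000000";
    "000000000000253101442110000000";
    "000000000000000000000000000000" ])%string.

Definition start_diagonal : tconfig := mkT table_diagonal (17, 5) DS.

(** The twelve sweeps cost 96 steps per block in all, and the window widths carry the strip from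
    column 3 to column 7, in accordance with the drift [(4, 4)]. *)
Definition rounds_diagonal : list round :=
  [ (229%nat, 4%nat, 6, (14%nat, 4%nat, 6)); (42%nat, 4%nat, 6, (26%nat, 4%nat, 4));
    (238%nat, 28%nat, 4, (70%nat, 4%nat, 4)); (206%nat, 4%nat, 4, (10%nat, 4%nat, 4));
    (46%nat, 4%nat, 4, (22%nat, 4%nat, 2)); (286%nat, 28%nat, 2, (42%nat, 4%nat, 2)) ].

(* The block of columns 3 and 4 of the table is repeated [K] times. *)
Definition wide_diagonal (K : nat) : ant_config :=
  mkConfig
    (fun p => look table_diagonal
       (if fst p <? 3 then fst p
        else if fst p <? 3 + 2 * Z.of_nat K then 3 + (fst p - 3) mod 2
        else fst p - 2 * (Z.of_nat K - 1), snd p))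
    (addZ2 (17, 5) (2 * (Z.of_nat K - 1), 0)) DS.

Lemma wide_diagonal_stretched K : (1 <= K)%nat ->
  stretched 3 K (wide_diagonal K) start_diagonal.
Proof.
  intros HK. split; [|split].
  - intros [x y] Hx. unfold addZ2. cbn [fst snd cells wide_diagonal tab start_diagonal] in *.
    rewrite !Z.add_0_r, Hx. reflexivity.
  - intros j Hj [x y] Hx. unfold addZ2. cbn [fst snd cells wide_diagonal tab start_diagonal] in *.
    boolz. destruct (Z.ltb_spec (x + 2 * j) 3); [lia|].
    destruct (Z.ltb_spec (x + 2 * j) (3 + 2 * Z.of_nat K)); [|lia].
    do 2 f_equal; [|lia].
    replace (x + 2 * j - 3) with (x - 3 + j * 2) by ring.
    rewrite Z.mod_add, Z.mod_small by lia. ring.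
  - intros [x y] Hx. unfold addZ2. cbn [fst snd cells wide_diagonal tab start_diagonal] in *.
    boolz. destruct (Z.ltb_spec (x + 2 * (Z.of_nat K - 1)) 3); [lia|].
    destruct (Z.ltb_spec (x + 2 * (Z.of_nat K - 1)) (3 + 2 * Z.of_nat K)).
    + lia.
    + do 2 f_equal; ring.
Qed.

(** After the six rounds, a run of 241 steps right of the strip closes the period. *)
Definition diagonal_check : bool :=
  match rounds w_LLRRRL rounds_diagonal 3 start_diagonal with
  | Some (a, b, e, s) =>
    match trun w_LLRRRL (right_of e) 241 s with
    | Some (_, s') => (a + 241 =? 1472)%nat && (b =? 96)%nat && (e =? 7) &&
        moved_by (4, 4) start_diagonal s' &&
        shift_check ahead (4, 4) (tab start_diagonal) (tab s')
    | None => false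
    end
  | None => false
  end.

Lemma wide_diagonal_drifts K : (1 <= K)%nat ->
  drifts w_LLRRRL (wide_diagonal K) (1472 + K * 96) (4, 4).
Proof.
  intros HK.
  assert (Hc : diagonal_check = true) by (vm_compute; reflexivity).
  unfold diagonal_check in Hc.
  destruct (rounds _ _ _ _) as [[[[a b] e] s]|] eqn:H1; [|discriminate].
  destruct (trun _ _ 241 s) as [[tr1 s1]|] eqn:H2; [|discriminate].
  rewrite !andb_true_iff, !Nat.eqb_eq, Z.eqb_eq in Hc.
  destruct Hc as [[[[Ha ->] ->] Hm] Hs].
  apply moved_by_spec in Hm. destruct Hm as [Hp Hh].
  pose proof (shift_check_spec _ _ _ _ Hs) as Hsh.
  pose proof (wide_diagonal_stretched K HK) as HS0.
  destruct (rounds_sound _ _ _ _ _ _ _ _ K (wide_diagonal K) H1 HK HS0)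
    as (tr & E & HR & HL & HS & HD); [split; reflexivity|].
  destruct (run_right _ _ K E s 241 tr1 s1 HK HS HD H2) as (E1 & HR1 & (SL & SB & SR) & [HP1 HH1]).
  pose proof (trun_length _ _ _ _ _ _ H2) as HL1.
  destruct (runs_app _ _ _ _ _ _ _ HR HR1) as [HE HV].
  rewrite length_app, HL, HL1 in HE, HV.
  replace (a + K * 96 + 241)%nat with (1472 + K * 96)%nat in HE, HV by lia.
  destruct HS0 as (SL0 & SB0 & SR0).
  apply (drifts_of_translate _ _ _ _ (ahead_wide K)).
  - lia.
  - intros [x y]. unfold ahead_wide, addZ2. cbn [fst snd]. lia.
  - intros i Hi. now apply HV.
  - rewrite <- HE, HP1, Hp. cbn [pos wide_diagonal tpos start_diagonal]. z2eq.
  - rewrite <- HE, HH1, Hh. reflexivity.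
  - rewrite <- HE. clear H1 H2 HE HV HR HR1. intros [x y] HA. unfold ahead_wide in HA. cbn [fst snd] in HA.
    (* The three zones of [stretched] are compared separately. The block now starts at column 7, so
       copy [j] is translated onto copy [j]. *)
    destruct (Z_lt_dec x 3) as [Hx|Hx]; [|destruct (Z_lt_dec x (3 + 2 * Z.of_nat K)) as [Hx'|Hx']].
    + specialize (SL (addZ2 (x, y) (4, 4))). specialize (SL0 (x, y)). specialize (Hsh (x, y)).
      rewrite addZ2_0_r in SL, SL0.
      rewrite SL, SL0, <- Hsh; [reflexivity| | |]; unfold ahead, upper, addZ2; cbn [fst snd]; boolz; lia.
    + assert (Hj : 0 <= (x - 3) / 2 < Z.of_nat K).
      { split; [apply Z.div_pos; lia|apply Z.div_lt_upper_bound; lia]. }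
      pose proof (Z.div_mod (x - 3) 2 ltac:(lia)) as Hdm.
      pose proof (Z.mod_pos_bound (x - 3) 2 ltac:(lia)) as Hmb.
      set (j := (x - 3) / 2) in *. set (r := (x - 3) mod 2) in *.
      specialize (SB j Hj (3 + r + 4, y + 4)). specialize (SB0 j Hj (3 + r, y)).
      specialize (Hsh (3 + r, y)).
      replace (addZ2 (x, y) (4, 4)) with (addZ2 (3 + r + 4, y + 4) (2 * j, 0))
        by (unfold addZ2; cbn [fst snd]; f_equal; lia).
      replace (x, y) with (addZ2 (3 + r, y) (2 * j, 0)) by (unfold addZ2; cbn [fst snd]; f_equal; lia).
      rewrite SB, SB0, <- Hsh; [reflexivity| | |]; unfold ahead, upper, addZ2; cbn [fst snd]; boolz; lia.
    + set (M := 2 * (Z.of_nat K - 1)) in *.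
      specialize (SR (x - M + 4, y + 4)). specialize (SR0 (x - M, y)).
      specialize (Hsh (x - M, y)).
      replace (addZ2 (x, y) (4, 4)) with (addZ2 (x - M + 4, y + 4) (M, 0))
        by (unfold addZ2; cbn [fst snd]; f_equal; lia).
      replace (x, y) with (addZ2 (x - M, y) (M, 0)) by (unfold addZ2; cbn [fst snd]; f_equal; lia).
      rewrite SR, SR0, <- Hsh; [reflexivity| | |]; unfold ahead, upper, addZ2; cbn [fst snd]; boolz; lia.
Qed.

Lemma wide_diagonal_finite K : finite_config w_LLRRRL (wide_diagonal K).
Proof.
  apply (finite_of_box _ _ 0 0 (30 + 2 * K) 20).
  - intros p. apply small_states_look; [cbn; lia|vm_compute; reflexivity].
  - intros x y Hout. cbn [wide_diagonal cells fst snd].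
    apply (look_outside _ 30 20); [vm_compute; reflexivity|].
    destruct (Z.ltb_spec x 3); [lia|].
    destruct (Z.ltb_spec x (3 + 2 * Z.of_nat K)); [|lia].
    pose proof (Z.mod_pos_bound (x - 3) 2 ltac:(lia)). lia.
Qed.

Lemma diagonal_highways : exists H : nat -> ant_config,
  (forall i, exists (n : nat) (a b : Z),
     is_highway w_LLRRRL (H i) n a b /\ diagonal_drift a b) /\
  (forall i j, i <> j -> ~ highway_equiv w_LLRRRL (H i) (H j)).
Proof.
  exists (fun i => wide_diagonal (S i)). split.
  - intros i.
    destruct (drifts_highway w_LLRRRL (wide_diagonal (S i)) (1472 + S i * 96) (4, 4))
      as (m & a & b & H & Ha & Hb & Hm).
    + apply wide_diagonal_finite.
    + lia.
    + apply wide_diagonal_drifts. lia.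
    + discriminate.
    + exists m, a, b. split; [assumption|]. left. cbn [fst snd] in Ha, Hb. nia.
  - intros i j Hij Heq.
    (* The drift is the same for all widths, so equivalence would equate these periods, which grow
       strictly with the number of blocks. *)
    assert (1472 + S i * 96 = 1472 + S j * 96)%nat; [|lia].
    eapply highway_equiv_period; [apply wide_diagonal_drifts; lia|apply wide_diagonal_drifts; lia| |exact Heq].
    discriminate.
Qed.

(** * The growing square *)

(* The frame around the growing square: four corners and, between them, four sides made of
   blocks of width 2, in the order in which the ant meets them. *)
Inductive chart : Type := BL | BB | BR | RB | TR | TB | TL | LB.

Definition next (c : chart) : chart :=
  match c with
  | BL => BB | BB => BR | BR => RB | RB => TR | TR => TB | TB => TL | TL => LB | LB => BL
  end.

Definition is_side (c : chart) : bool :=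
  match c with BB | RB | TB | LB => true | _ => false end.

(** The table is cut along columns 41 and 42 and rows 24 and 25, which carry the repeated blocks. Of
    the two middle rows only the outer columns are kept; the cells between them belong to no chart,
    and the guards of the simulation show that the ant stays off them. *)
Definition dom (c : chart) (p : Z * Z) : bool :=
  let '(x, y) := p in
  match c with
  | BL => (x <? 41) && (y <? 24)
  | BB => (41 <=? x) && (x <? 43) && (y <? 24)
  | BR => (43 <=? x) && (y <? 24)
  | RB => (61 <=? x) && (24 <=? y) && (y <? 26)
  | TR => (43 <=? x) && (26 <=? y)
  | TB => (41 <=? x) && (x <? 43) && (26 <=? y)
  | TL => (x <? 41) && (26 <=? y)
  | LB => (x <? 12) && (24 <=? y) && (y <? 26)
  end.

Definition dirn (c : chart) : Z * Z :=
  match c with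
  | BB => (2, 0) | RB => (0, 2) | TB => (-2, 0) | LB => (0, -2) | _ => (0, 0)
  end.

(** In cycle [n] the corners are displaced outwards by [2 * n] in both coordinates. A side starts at
    the corner met before it; the last of its [2 * n + 1] copies is displaced by a further [4 * n],
    which is the offset of the next corner. *)
Definition base (n : Z) (c : chart) : Z * Z :=
  match c with
  | BL | BB => (-2 * n, -2 * n)
  | BR | RB => (2 * n, -2 * n)
  | TR | TB => (2 * n, 2 * n)
  | TL | LB => (-2 * n, 2 * n)
  end.

Definition offs (n : Z) (c : chart) (j : Z) : Z * Z := addZ2 (base n c) (smul j (dirn c)).

(** On a corner [dirn] vanishes and all [j] express the same condition; on a side [j] numbers the
    copies of the block. *)
Definition covers (n : Z) (E : ant_config) (s : tconfig) : Prop :=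
  forall c j, 0 <= j <= 2 * n -> matches (dom c) E s (offs n c j).

Ltac offz := unfold offs, base, dirn, smul, addZ2, dom in *; cbn [fst snd] in *.

(** This makes the charts independent: a run in one of them leaves all others intact. *)
Lemma offs_disjoint n c c' j j' p p' : 0 <= j <= 2 * n -> 0 <= j' <= 2 * n ->
  dom c p = true -> dom c' p' = true ->
  addZ2 p (offs n c j) = addZ2 p' (offs n c' j') -> c = c' /\ p = p'.
Proof.
  destruct p as [x y], p' as [x' y']. intros Hj Hj' Hp Hp' Heq.
  unfold addZ2 in Heq at 1 2. apply pair_equal_spec in Heq. destruct Heq as [H1 H2].
  destruct c, c'; offz; boolz;
    first [exfalso; lia | split; [reflexivity|f_equal; lia]].
Qed.

(** These are the 74 by 44 cells of [table_square]; confining runs to them bounds the distance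
    between the ant and the offsets of the charts. *)
Definition inbox (p : Z * Z) : bool :=
  (0 <=? fst p) && (fst p <? 74) && (0 <=? snd p) && (snd p <? 44).

Definition region (c : chart) (p : Z * Z) : bool := dom c p && inbox p.

Definition near_frame (n : Z) (p : Z * Z) : Prop :=
  exists c j q, 0 <= j <= 2 * n /\ inbox q = true /\ p = addZ2 q (offs n c j).

Lemma offs_0 n c : offs n c 0 = base n c.
Proof. unfold offs, smul. destruct (base n c), (dirn c). z2eq. Qed.

Lemma offs_corner n c j : is_side c = false -> offs n c j = base n c.
Proof. intros H. destruct c; try discriminate H; unfold offs, base, dirn, smul; z2eq. Qed.

Lemma run_corner w n c E s m tr s' : is_side c = false -> 0 <= n ->
  covers n E s -> docked E s (base n c) ->
  trun w (region c) m s = Some (tr, s') ->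
  exists E', runs w (near_frame n) E tr E' /\ covers n E' s' /\ docked E' s' (base n (next c)).
Proof.
  intros Hc Hn HC HD Hr.
  pose proof (trun_frame _ _ _ _ _ _ Hr) as Hf.
  destruct (trun_sound _ _ _ _ _ _ _ _ Hr HD) as (E' & Hrun & _ & Hd' & Hm & Hfr & _).
  { intros p Hp. unfold region in Hp. apply andb_true_iff in Hp.
    rewrite <- offs_0. apply HC; [lia|apply Hp]. }
  exists E'. split; [|split].
  - eapply runs_weaken; [|exact Hrun]. intros p (q & Hq & ->).
    exists c, 0, q. rewrite offs_0. unfold region in Hq. apply andb_true_iff in Hq.
    repeat split; try lia; apply Hq.
  - intros c' j Hj p Hp.
    destruct (region c p) eqn:Er.
    + assert (c' = c) as ->.
      { unfold region in Er. apply andb_true_iff in Er.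
        eapply (offs_disjoint 0 c' c 0 0 p p); try lia; try apply Er; auto.
        destruct c', c; offz; reflexivity. }
      rewrite offs_corner by assumption. now apply Hm.
    + rewrite Hf by assumption. rewrite Hfr; [now apply HC|].
      intros q Hq Heq. rewrite <- (offs_0 n c) in Heq.
      unfold region in Hq. apply andb_true_iff in Hq.
      destruct (offs_disjoint n c' c j 0 p q) as [-> ->]; try lia; try apply Hq; auto.
      unfold region in Er. rewrite (proj1 Hq), (proj2 Hq) in Er. discriminate.
  - replace (base n (next c)) with (base n c) by (destruct c; try discriminate Hc; reflexivity).
    assumption.
Qed.

(** A sweep with empty window: each traversal stays inside the domain of its own block. The last
    clause, a visit near every copy, prepares condition (ii) of previsibility. *)
Lemma run_side w (n : nat) c E s m tr s' : is_side c = true ->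
  covers (Z.of_nat n) E s -> docked E s (base (Z.of_nat n) c) ->
  trun w (region c) m s = Some (tr, s') -> moved_by (dirn c) s s' = true -> (0 < m)%nat ->
  exists E', runs w (near_frame (Z.of_nat n)) E (concat (repeat tr (S (2 * n)))) E' /\
    covers (Z.of_nat n) E' s' /\ docked E' s' (base (Z.of_nat n) (next c)) /\
    (forall j, 0 <= j <= 2 * Z.of_nat n -> exists i q,
       (i < S (2 * n) * m)%nat /\ inbox q = true /\
       trajectory w E i = addZ2 q (offs (Z.of_nat n) c j)).
Proof.
  intros Hc HC HD Hr Hmv Hm0.
  apply moved_by_spec in Hmv. destruct Hmv as [Hp Hh].
  pose proof (trun_frame _ _ _ _ _ _ Hr) as Hf.
  assert (Hpos : inbox (tpos s) = true).
  { destruct m; [lia|]. cbn in Hr. destruct (region c (tpos s)) eqn:Hreg; [|discriminate].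
    now apply andb_true_iff in Hreg. }
  destruct (sweep_sound w (region c) (fun _ => false) (dom c) (dirn c) (base (Z.of_nat n) c)
     m s s' tr (S (2 * n)) E Hr Hp Hh) as (E' & Hrun & Hd' & _ & HmA & Hfr & Htr).
  - intros p Hq. unfold region in Hq. now apply andb_true_iff in Hq.
  - discriminate.
  - intros [x y] j Hj Hd. unfold region. apply andb_false_iff. left.
    destruct c; try discriminate Hc; offz; boolz; lia.
  - intros [x y] j Hj Hd. unfold region. apply andb_false_iff. left.
    destruct c; try discriminate Hc; offz; boolz; lia.
  - assumption.
  - intros p Hd. discriminate Hd.
  - intros j Hj. apply HC. lia.
  - exists E'. split; [|split; [|split]].
    + eapply runs_weaken; [|exact Hrun]. intros p (j & q & Hj & Hq & ->).
      exists c, j, q. unfold region in Hq. apply andb_true_iff in Hq.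
      repeat split; try lia; apply Hq.
    + intros c' j Hj p Hd.
      destruct (region c p) eqn:Er.
      * assert (c' = c) as ->.
        { unfold region in Er. apply andb_true_iff in Er.
          eapply (offs_disjoint 0 c' c 0 0 p p); try lia; try apply Er; auto.
          destruct c', c; offz; reflexivity. }
        apply HmA; [lia|]. cbn [orb negb]. now rewrite Hd.
      * rewrite Hf by assumption. rewrite Hfr; [now apply HC|].
        intros j' q Hj' Hq Heq.
        unfold region in Hq. apply andb_true_iff in Hq.
        destruct (offs_disjoint (Z.of_nat n) c' c j j' p q) as [-> ->]; try lia; try apply Hq; auto.
        unfold region in Er. rewrite (proj1 Hq), (proj2 Hq) in Er. discriminate.
    + destruct Hd' as [Hp' Hh']. split; [|congruence].
      (* The [2 * n + 1] displacements exceed the way to the next corner by one, which is already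
         contained in [tpos s']. *)
      rewrite Hp', Hp. rewrite Nat2Z.inj_succ, Nat2Z.inj_mul. cbn [Z.of_nat].
      destruct (tpos s) as [x y].
      destruct c; try discriminate Hc; unfold base, next, dirn, smul, addZ2; cbn [fst snd]; f_equal; lia.
    + intros j Hj. exists (Z.to_nat j * m)%nat, (tpos s). split; [nia|split; [assumption|]].
      rewrite Htr by lia. rewrite Z2Nat.id by lia. reflexivity.
Qed.

(** A side crossed [2 * n + 1] times contributes [tr (tr tr)^n], a corner contributes [tr] and an
    empty word to the power [n]. The pairs collected are therefore those of an interlaced word. *)
Fixpoint tour (w : list letter) (ops : list nat) (c : chart) (s : tconfig)
    : option (list (list nat * list nat) * chart * tconfig) :=
  match ops with
  | [] => Some ([], c, s)
  | m :: ops' =>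
    match trun w (region c) m s with
    | None => None
    | Some (tr, s') =>
      if negb (is_side c) || (moved_by (dirn c) s s' && (0 <? m)%nat) then
        match tour w ops' (next c) s' with
        | Some (uv, c', s'') =>
            Some ((tr, if is_side c then tr ++ tr else []) :: uv, c', s'')
        | None => None
        end
      else None
    end
  end.

Lemma concat_repeat_double {A : Type} (l : list A) n :
  concat (repeat (l ++ l) n) = concat (repeat l (2 * n)).
Proof.
  induction n as [|n IH]; [reflexivity|].
  replace (2 * S n)%nat with (S (S (2 * n))) by lia. cbn [repeat concat]. rewrite IH.
  now rewrite app_assoc.
Qed.

Lemma concat_repeat_nil {A : Type} n : concat (repeat (@nil A) n) = [].
Proof. now induction n. Qed.

Lemma tour_sound w (n : nat) ops : forall c s uv c' s' E,
  tour w ops c s = Some (uv, c', s') ->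
  covers (Z.of_nat n) E s -> docked E s (base (Z.of_nat n) c) ->
  exists E', runs w (near_frame (Z.of_nat n)) E (interlace_block uv n) E' /\
    covers (Z.of_nat n) E' s' /\ docked E' s' (base (Z.of_nat n) c') /\
    (forall k j, (k < length ops)%nat -> is_side (Nat.iter k next c) = true ->
       0 <= j <= 2 * Z.of_nat n -> exists i q,
       (i < length (interlace_block uv n))%nat /\ inbox q = true /\
       trajectory w E i = addZ2 q (offs (Z.of_nat n) (Nat.iter k next c) j)).
Proof.
  induction ops as [|m ops IH]; cbn [tour]; intros c s uv c' s' E H HC HD.
  - injection H as <- <- <-. exists E. split; [apply runs_nil|].
    split; [assumption|split; [assumption|]]. cbn. lia.
  - destruct (trun w (region c) m s) as [[tr s1]|] eqn:H1; [|discriminate].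
    destruct (negb (is_side c) || _) eqn:Hmv; [|discriminate].
    destruct (tour w ops (next c) s1) as [[[uv' c1] s2]|] eqn:H2; [|discriminate].
    injection H as <- <- <-.
    assert (Hstep : exists E1,
      runs w (near_frame (Z.of_nat n)) E
        (tr ++ concat (repeat (if is_side c then tr ++ tr else []) n)) E1 /\
      covers (Z.of_nat n) E1 s1 /\ docked E1 s1 (base (Z.of_nat n) (next c)) /\
      (is_side c = true -> forall j, 0 <= j <= 2 * Z.of_nat n -> exists i q,
       (i < length (tr ++ concat (repeat (if is_side c then tr ++ tr else []) n)))%nat /\
       inbox q = true /\ trajectory w E i = addZ2 q (offs (Z.of_nat n) c j))).
    { destruct (is_side c) eqn:Hc.
      - cbn [negb orb] in Hmv. apply andb_true_iff in Hmv. destruct Hmv as [Hmv Hm0].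
        apply Nat.ltb_lt in Hm0.
        destruct (run_side w n c E s m tr s1 Hc HC HD H1 Hmv Hm0) as (E1 & R1 & C1 & D1 & T1).
        exists E1. rewrite concat_repeat_double.
        change (tr ++ concat (repeat tr (2 * n))) with (concat (repeat tr (S (2 * n)))).
        split; [assumption|split; [assumption|split; [assumption|]]].
        intros _. rewrite length_concat_repeat, (trun_length _ _ _ _ _ _ H1). exact T1.
      - destruct (run_corner w (Z.of_nat n) c E s m tr s1 Hc ltac:(lia) HC HD H1)
          as (E1 & R1 & C1 & D1).
        exists E1. rewrite concat_repeat_nil, app_nil_r.
        split; [assumption|split; [assumption|split; [assumption|discriminate]]]. }
    destruct Hstep as (E1 & R1 & C1 & D1 & T1).
    destruct (IH _ _ _ _ _ E1 H2 C1 D1) as (E2 & R2 & C2 & D2 & T2).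
    exists E2.
    change (interlace_block ((tr, if is_side c then tr ++ tr else []) :: uv') n) with
      ((tr ++ concat (repeat (if is_side c then tr ++ tr else []) n)) ++ interlace_block uv' n).
    split; [eauto using runs_app|split; [assumption|split; [assumption|]]].
    intros k j Hk Hs Hj. rewrite length_app. destruct k as [|k].
    + destruct (T1 Hs j Hj) as (i & q & Hi & Hq). exists i, q. split; [lia|assumption].
    + rewrite Nat.iter_succ_r in Hs |- *. cbn [length] in Hk.
      destruct (T2 k j ltac:(lia) Hs Hj) as (i & q & Hi & Hq & Ht).
      exists (length (tr ++ concat (repeat (if is_side c then tr ++ tr else []) n)) + i)%nat, q.
      split; [lia|split; [assumption|]].
      rewrite trajectory_add. destruct R1 as [<- _]. assumption.
Qed.

(** In cycle [n + 1] a side has two more copies: the first and the last arise from the adjacent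
    corners, the others from the same side pushed outwards. Hence three comparisons for a side and
    one for a corner. *)
Definition growth : list (chart * (Z * Z)) :=
  [ (BL, (-2, -2)); (BR, (2, -2)); (TR, (2, 2)); (TL, (-2, 2));
    (BB, (-2, -2)); (BB, (0, -2)); (BB, (2, -2));
    (RB, (2, -2)); (RB, (2, 0)); (RB, (2, 2));
    (TB, (2, 2)); (TB, (0, 2)); (TB, (-2, 2));
    (LB, (-2, 2)); (LB, (-2, 0)); (LB, (-2, -2)) ].

Definition growth_check (s s' : tconfig) : bool :=
  forallb (fun cd => shift_check (dom (fst cd)) (snd cd) (tab s) (tab s')) growth.

Ltac grow_case Hc H c d c' j' :=
  apply (Hc c d c' j'); [cbn; tauto|exact H|offz; boolz; lia|lia|offz; f_equal; lia].

Lemma covers_grow n E s s' : 0 <= n -> growth_check s s' = true ->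
  covers n E s' -> covers (n + 1) E s.
Proof.
  intros Hn Hg HC.
  (* A cell of the larger frame is rewritten as a cell of some piece [c'] of the smaller one, where
     [growth_check] compares the tables. *)
  assert (Hc : forall c d c' j' p t, In (c, d) growth -> dom c p = true ->
    dom c' (addZ2 p d) = true -> 0 <= j' <= 2 * n ->
    addZ2 p t = addZ2 (addZ2 p d) (offs n c' j') ->
    cells E (addZ2 p t) = look (tab s) p).
  { intros c d c' j' p t Hin Hp Hp' Hj' ->.
    rewrite (HC c' j' Hj' _ Hp').
    unfold growth_check in Hg. rewrite forallb_forall in Hg.
    exact (shift_check_spec _ _ _ _ (Hg _ Hin) p Hp). }
  intros c j Hj [x y] Hp.
  destruct c.
  - grow_case Hc Hp BL (-2, -2) BL 0.
  - destruct (Z.eq_dec j 0) as [->|H0]; [grow_case Hc Hp BB (-2, -2) BL 0|].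
    destruct (Z.eq_dec j (2 * n + 2)) as [->|H2]; [grow_case Hc Hp BB (2, -2) BR 0|].
    grow_case Hc Hp BB (0, -2) BB (j - 1).
  - grow_case Hc Hp BR (2, -2) BR 0.
  - destruct (Z.eq_dec j 0) as [->|H0]; [grow_case Hc Hp RB (2, -2) BR 0|].
    destruct (Z.eq_dec j (2 * n + 2)) as [->|H2]; [grow_case Hc Hp RB (2, 2) TR 0|].
    grow_case Hc Hp RB (2, 0) RB (j - 1).
  - grow_case Hc Hp TR (2, 2) TR 0.
  - destruct (Z.eq_dec j 0) as [->|H0]; [grow_case Hc Hp TB (2, 2) TR 0|].
    destruct (Z.eq_dec j (2 * n + 2)) as [->|H2]; [grow_case Hc Hp TB (-2, 2) TL 0|].
    grow_case Hc Hp TB (0, 2) TB (j - 1).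
  - grow_case Hc Hp TL (-2, 2) TL 0.
  - destruct (Z.eq_dec j 0) as [->|H0]; [grow_case Hc Hp LB (-2, 2) TL 0|].
    destruct (Z.eq_dec j (2 * n + 2)) as [->|H2]; [grow_case Hc Hp LB (-2, -2) BL 0|].
    grow_case Hc Hp LB (-2, 0) LB (j - 1).
Qed.

Definition table_square : list (list nat) :=
  picture ([
    "00000000000000000000000000000000000000000000000000000000000000000000000000";
    "00000000000000000000000000000000000000000000000000000000000000000000000000";
    "00000000000000000000000000000000000000000000000000000000000000000000000000";
    "00000000000000000000000000000000000000000000000000000000000000000000000000";
    "00000111111111111111111111111111111111111111111111111111111111111111100000";
    "00001243333333333333333333333333333333333333333333333333333333333334210000";
    "00001445444444444444444444444444444444444444444444444444444444444454410000";
    "00001354544444444444444444444444444444444444444444444444444444444545310000";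
    "00001345454444444444444444444444444444444444444444444444444444445454310000";
    "00001344545444444444444444444444444444444444444444444444444444454544310000";
    "00001344454544444444444444444444444444444444444444444444444444545444310000";
    "00001344445454444444444444444444444444444444444444444444444445454444310000";
    "00001344444545444444444444444444444444444444444444444444444454544444310000";
    "00001344444454544444444444444444444444444444444444444444444545444444310000";
    "00001344444445454444444444444444444444444444444444444444445454444444310000";
    "00001344444444545444444444444444444444444444444444444444454544444444310000";
    "00001344444444454544444444444444444444444444444444444444545444444444310000";
    "00001344444444445454444444444444444444444444444444444445454444444444310000";
    "00001344444444445454251544545454145444444444444545424445454444444444310000";
    "00001344444444454543552515454541454444444444444454542444545444444444310000";
    "00001344444444545425154454545414544444444444444445454244454544444444310000";
    "00001344444445454355251545454145444444444444444444545424445454444444310000";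
    "00001344444454542515445454541454444444444444444444454542444545444444310000";
    "00001344444545435525154545414544444444444444444444445454244454544444310000";
    "00001344445454251544545454145444444444444444444444444545424445454444310000";
    "00001344454543552515454541454444444444444444444444444454542444545444310000";
    "00001344545425154454545414544444444444444444444444444445454244454544310000";
    "00001345454355251545454145444444444444444444444444444444545424445454310000";
    "00001354542515445454541454444444444444444444444444444444454542444545310000";
    "00001445435525154545414544444444444444444444444444444444445454244454410000";
    "00001243251544545454145444444444444444444444444444444444444545423334210000";
    "00000111352515454541454444444444444444444444444444444444444454531111100000";
    "00000001443354544314544444444444444444444444444444444444444445441000000000";
    "00000001414333221035444444444333333333333333333333333333333333421000000000";
    "00000001530110055122222222222111111111111111111111111111111111110000000000";
    "00000001535050551000000000000000000000000000000000000000000000000000000000";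
    "00000002035505510000000000000000000000000000000000000000000000000000000000";
    "00000002033335100000000000000000000000000000000000000000000000000000000000";
    "00000001400531000000000000000000000000000000000000000000000000000000000000";
    "00000001122110000000000000000000000000000000000000000000000000000000000000";
    "00000000000000000000000000000000000000000000000000000000000000000000000000";
    "00000000000000000000000000000000000000000000000000000000000000000000000000";
    "00000000000000000000000000000000000000000000000000000000000000000000000000";
    "00000000000000000000000000000000000000000000000000000000000000000000000000" ])%string.

Definition start_square : tconfig := mkT table_square (29, 9) DE.

(** Four turns through the eight charts, each block being crossed in 4 steps, and a last run in the
    bottom left corner. The tour thus ends in chart [BB], whose base is that of [BL]. *)
Definition tour_square : list nat :=
  [ 24; 4; 77; 4; 77; 4; 97; 4; 177; 4; 89; 4; 85; 4; 105; 4; 121; 4; 81; 4; 81; 4; 101; 4;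
    149; 4; 93; 4; 89; 4; 109; 4; 149 ]%nat.

Definition words_square : list (list nat * list nat) :=
  match tour w_LLRRRL tour_square BL start_square with
  | Some (uv, _, _) => uv
  | None => []
  end.

(** The condition on [uv] makes the first word nonempty, so that every cycle takes at least one
    step. *)
Definition square_check : bool :=
  match tour w_LLRRRL tour_square BL start_square with
  | Some (uv, BB, s) =>
      moved_by (-2, -2) start_square s && growth_check start_square s &&
      match uv with (_ :: _, _) :: _ => true | _ => false end
  | _ => false
  end.

Lemma square_checked : square_check = true.
Proof. vm_compute. reflexivity. Qed.

Lemma square_cycle (n : nat) E :
  covers (Z.of_nat n) E start_square -> docked E start_square (base (Z.of_nat n) BL) ->
  exists E', runs w_LLRRRL (near_frame (Z.of_nat n)) E (interlace_block words_square n) E' /\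
    covers (Z.of_nat (S n)) E' start_square /\
    docked E' start_square (base (Z.of_nat (S n)) BL) /\
    (forall c j, is_side c = true -> 0 <= j <= 2 * Z.of_nat n -> exists i q,
       (i < length (interlace_block words_square n))%nat /\ inbox q = true /\
       trajectory w_LLRRRL E i = addZ2 q (offs (Z.of_nat n) c j)).
Proof.
  intros HC HD. pose proof square_checked as Hk. unfold square_check in Hk.
  unfold words_square.
  destruct (tour _ _ _ _) as [[[uv c] s]|] eqn:Ht; [|discriminate].
  destruct c; try discriminate Hk.
  rewrite !andb_true_iff in Hk. destruct Hk as [[Hm Hg] _].
  apply moved_by_spec in Hm. destruct Hm as [Hp Hh].
  destruct (tour_sound _ n _ _ _ _ _ _ E Ht HC HD) as (E' & HR & HC' & [Hp' Hh'] & HT).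
  exists E'. split; [assumption|split; [|split]].
  - rewrite Nat2Z.inj_succ. apply (covers_grow _ _ _ s); auto. lia.
  - split; [|congruence]. rewrite Hp', Hp, Nat2Z.inj_succ.
    unfold base. cbn [tpos start_square]. z2eq.
  - intros c j Hc Hj.
    (* The sides occupy places 1, 3, 5 and 7 of the first turn. *)
    destruct c; try discriminate Hc;
      [apply (HT 1%nat j)|apply (HT 3%nat j)|apply (HT 5%nat j)|apply (HT 7%nat j)];
      try assumption; try reflexivity; cbn; lia.
Qed.

Lemma words_square_length n : (0 < length (interlace_block words_square n))%nat.
Proof.
  pose proof square_checked as Hk. unfold square_check in Hk. unfold words_square.
  destruct (tour _ _ _ _) as [[[uv c] s]|]; [|discriminate].
  destruct c; try discriminate Hk.
  destruct uv as [|[[|a u] v] uv]; try (rewrite andb_false_r in Hk; discriminate Hk).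
  unfold interlace_block. cbn. lia.
Qed.

(** * Concatenation of the cycles and the clock that counts them *)

Lemma interlace_prefix_S uv N :
  interlace_prefix uv (S N) = interlace_prefix uv N ++ interlace_block uv N.
Proof.
  unfold interlace_prefix. rewrite seq_S, map_app, concat_app. cbn. now rewrite app_nil_r.
Qed.

Definition cycle_start (n : nat) : nat := length (interlace_prefix words_square n).

Lemma cycle_start_S n :
  cycle_start (S n) = (cycle_start n + length (interlace_block words_square n))%nat.
Proof. unfold cycle_start. now rewrite interlace_prefix_S, length_app. Qed.

Lemma cycle_start_lt n : (cycle_start n < cycle_start (S n))%nat.
Proof. rewrite cycle_start_S. pose proof (words_square_length n). lia. Qed.

Lemma cycle_start_mono m n : (m <= n)%nat -> (cycle_start m + (n - m) <= cycle_start n)%nat.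
Proof.
  induction 1 as [|n H IH]; [lia|]. pose proof (cycle_start_lt n). lia.
Qed.

Lemma square_prefix (N : nat) : exists E,
  runs w_LLRRRL (fun _ => True) (den start_square) (interlace_prefix words_square N) E /\
  covers (Z.of_nat N) E start_square /\ docked E start_square (base (Z.of_nat N) BL).
Proof.
  induction N as [|N (E & HR & HC & HD)].
  - exists (den start_square). split; [apply runs_nil|split].
    (* In cycle 0 all offsets vanish, so the table itself is the frame. *)
    + intros c j Hj. replace (offs (Z.of_nat 0) c j) with ((0, 0) : Z * Z).
      * apply den_matches.
      * replace j with 0 by (cbn in Hj; lia). destruct c; reflexivity.
    + apply den_docked.
  - destruct (square_cycle N E HC HD) as (E' & HR' & HC' & HD' & _).
    exists E'. rewrite interlace_prefix_S. split; [|split; assumption].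
    eapply runs_app; [exact HR|]. eapply runs_weaken; [|exact HR']. auto.
Qed.

Lemma square_interlaced : interlaced (trace w_LLRRRL (den start_square)).
Proof.
  exists words_square. split; [|split].
  - intros H. pose proof (words_square_length 0) as Hl. rewrite H in Hl. cbn in Hl. lia.
  - intros N i Hi. destruct (square_prefix N) as (E & [_ HR] & _). now apply HR.
  - intros M. exists M. pose proof (cycle_start_mono 0 M ltac:(lia)). unfold cycle_start in *. lia.
Qed.

Lemma square_near n i : (i < length (interlace_block words_square n))%nat ->
  near_frame (Z.of_nat n) (trajectory w_LLRRRL (den start_square) (cycle_start n + i)).
Proof.
  intros Hi. destruct (square_prefix n) as (E & [HE _] & HC & HD).
  destruct (square_cycle n E HC HD) as (E' & [_ HR] & _).
  rewrite trajectory_add. unfold cycle_start. rewrite <- HE. now apply HR.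
Qed.

Lemma square_visits n c j : is_side c = true -> 0 <= j <= 2 * Z.of_nat n -> exists i q,
  (i < length (interlace_block words_square n))%nat /\ inbox q = true /\
  trajectory w_LLRRRL (den start_square) (cycle_start n + i) = addZ2 q (offs (Z.of_nat n) c j).
Proof.
  intros Hc Hj. destruct (square_prefix n) as (E & [HE _] & HC & HD).
  destruct (square_cycle n E HC HD) as (E' & _ & _ & _ & HT).
  destruct (HT c j Hc Hj) as (i & q & Hi & Hq & Ht). exists i, q.
  rewrite trajectory_add. unfold cycle_start. rewrite <- HE. auto.
Qed.

(** Cycles have positive length, so one step of time enters at most one new cycle. This counter is
    the dilation factor of the previsible trajectory. *)
Fixpoint cycle_of (t : nat) : nat :=
  match t with
  | 0%nat => 0%nat
  | S t' => if (cycle_start (S (cycle_of t')) <=? S t')%nat then S (cycle_of t') else cycle_of t'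
  end.

Lemma cycle_of_spec t : (cycle_start (cycle_of t) <= t < cycle_start (S (cycle_of t)))%nat.
Proof.
  induction t as [|t IH]; cbn [cycle_of].
  - pose proof (cycle_start_lt 0). change (cycle_start 0) with 0%nat in *. lia.
  - destruct (Nat.leb_spec (cycle_start (S (cycle_of t))) (S t)) as [H|H]; [|lia].
    pose proof (cycle_start_lt (S (cycle_of t))). lia.
Qed.

Lemma cycle_of_mono m n : (m <= n)%nat -> (cycle_of m <= cycle_of n)%nat.
Proof.
  induction 1 as [|n H IH]; [lia|]. cbn [cycle_of]. destruct (_ <=? _)%nat; lia.
Qed.

Lemma cycle_of_start n i : (i < length (interlace_block words_square n))%nat ->
  cycle_of (cycle_start n + i) = n.
Proof.
  intros Hi. pose proof (cycle_of_spec (cycle_start n + i)) as H.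
  pose proof (cycle_start_S n).
  set (m := cycle_of _) in *.
  destruct (Nat.lt_trichotomy m n) as [Hlt|[->|Hgt]]; [|reflexivity|].
  - pose proof (cycle_start_mono (S m) n Hlt). lia.
  - pose proof (cycle_start_mono (S n) m Hgt). lia.
Qed.

(** * The square, its boundary and previsibility *)

Local Open Scope R_scope.

(** The half-side 2 is chosen so that dilation by [n] puts the vertices at the values of [base] in
    cycle [n]. *)
Definition square (z : pt) : Prop := (-2 <= fst z <= 2) /\ (-2 <= snd z <= 2).

Lemma dist2_le p q k : 0 <= k -> (fst p - fst q)^2 + (snd p - snd q)^2 <= k^2 -> dist2 p q <= k.
Proof.
  intros Hk H. unfold dist2. rewrite <- (sqrt_pow2 k Hk). now apply sqrt_le_1_alt.
Qed.

Lemma dist2_fst p q : Rabs (fst p - fst q) <= dist2 p q.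
Proof.
  unfold dist2. rewrite <- sqrt_Rsqr_abs. apply sqrt_le_1_alt. unfold Rsqr.
  pose proof (pow2_ge_0 (snd p - snd q)). nra.
Qed.

Lemma dist2_snd p q : Rabs (snd p - snd q) <= dist2 p q.
Proof.
  unfold dist2. rewrite <- sqrt_Rsqr_abs. apply sqrt_le_1_alt. unfold Rsqr.
  pose proof (pow2_ge_0 (fst p - fst q)). nra.
Qed.

Lemma dist2_lt_coord p q e : dist2 p q < e ->
  - e < fst p - fst q < e /\ - e < snd p - snd q < e.
Proof.
  intros H. pose proof (dist2_fst p q). pose proof (dist2_snd p q).
  split; apply and_comm, Rabs_def2; lra.
Qed.

Lemma square_closed : closed_set square.
Proof.
  intros [a b] H. unfold square. cbn [fst snd].
  repeat split; apply Rnot_lt_le; intros Hlt;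
    [destruct (H (-2 - a)) as ([a' b'] & Hq & Hd)|destruct (H (a - 2)) as ([a' b'] & Hq & Hd)
    |destruct (H (-2 - b)) as ([a' b'] & Hq & Hd)|destruct (H (b - 2)) as ([a' b'] & Hq & Hd)];
    try lra; apply dist2_lt_coord in Hd; unfold square in Hq; cbn [fst snd] in *; lra.
Qed.

Lemma square_bounded : bounded_set square.
Proof.
  exists 4. intros [a b] [Ha Hb]. apply dist2_le; [lra|]. cbn [fst snd] in *. nra.
Qed.

Lemma square_rectangle : is_rectangle square.
Proof.
  exists (-2, -2), (4, 0), (0, 4). split; [|split; [|split]].
  - intros [= H]. lra.
  - intros [= H]. lra.
  - cbn. ring.
  - intros [a b]. unfold square. cbn [fst snd]. split.
    + intros [Ha Hb]. exists ((a + 2) / 4), ((b + 2) / 4).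
      split; [lra|split; [lra|]]. f_equal; field.
    + intros (s & t & Hs & Ht & [= -> ->]). lra.
Qed.

Lemma square_boundary_inv a b : boundary square (a, b) ->
  (-2 <= a <= 2) /\ (-2 <= b <= 2) /\ (a = -2 \/ a = 2 \/ b = -2 \/ b = 2).
Proof.
  intros H.
  assert (Hin : square (a, b)) by (apply square_closed; intros e He; apply H, He).
  destruct Hin as [Ha Hb]. cbn [fst snd] in *. split; [assumption|split; [assumption|]].
  destruct (Rle_lt_or_eq_dec _ _ (proj1 Ha)) as [H1|]; [|lra].
  destruct (Rle_lt_or_eq_dec _ _ (proj2 Ha)) as [H2|]; [|lra].
  destruct (Rle_lt_or_eq_dec _ _ (proj1 Hb)) as [H3|]; [|lra].
  destruct (Rle_lt_or_eq_dec _ _ (proj2 Hb)) as [H4|]; [|lra].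
  exfalso.
  (* [e] is the distance to the nearest side, so the ball of radius [e] stays in the square. *)
  set (e := Rmin (Rmin (a + 2) (2 - a)) (Rmin (b + 2) (2 - b))).
  assert (He : 0 < e) by (unfold e; repeat apply Rmin_glb_lt; lra).
  destruct (H e He) as [_ ([a' b'] & Hq & Hd)]. apply Hq.
  apply dist2_lt_coord in Hd. cbn [fst snd] in Hd.
  assert (e <= a + 2 /\ e <= 2 - a /\ e <= b + 2 /\ e <= 2 - b) as (E1 & E2 & E3 & E4).
  { unfold e. pose proof (Rmin_l (Rmin (a + 2) (2 - a)) (Rmin (b + 2) (2 - b))).
    pose proof (Rmin_r (Rmin (a + 2) (2 - a)) (Rmin (b + 2) (2 - b))).
    pose proof (Rmin_l (a + 2) (2 - a)). pose proof (Rmin_r (a + 2) (2 - a)).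
    pose proof (Rmin_l (b + 2) (2 - b)). pose proof (Rmin_r (b + 2) (2 - b)). lra. }
  unfold square. cbn [fst snd]. lra.
Qed.

Lemma dilated_square_boundary r a b :
  0 <= r -> -2 * r <= a <= 2 * r -> -2 * r <= b <= 2 * r ->
  (a = -2 * r \/ a = 2 * r \/ b = -2 * r \/ b = 2 * r) ->
  boundary (dil_trans r 0 (1, 0) square) (a, b).
Proof.
  intros Hr Ha Hb Hside e He. split.
  - exists (a, b). split; [|unfold dist2; cbn [fst snd]; rewrite !Rminus_diag, pow_i, Rplus_0_l, sqrt_0 by lia; lra].
    (* For [r = 0], which occurs in cycle 0, the dilated square is the single point 0. *)
    destruct (Rle_lt_or_eq_dec _ _ Hr) as [Hr' | <-].
    + exists (a / r, b / r). split.
      * assert (Hd : forall c, -2 * r <= c <= 2 * r -> -2 <= c / r <= 2).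
        { intros c Hc. split; [apply Rmult_le_reg_r with r|apply Rmult_le_reg_r with r];
            try lra; unfold Rdiv; rewrite Rmult_assoc, Rinv_l; lra. }
        split; cbn [fst snd]; auto.
      * cbn [fst snd]. f_equal; field; lra.
    + exists (0, 0). split; [unfold square; cbn [fst snd]; lra|].
      cbn [fst snd]. f_equal; lra.
  - assert (Hout : forall x y, ~ (-2 * r <= x <= 2 * r /\ -2 * r <= y <= 2 * r) ->
      ~ dil_trans r 0 (1, 0) square (x, y)).
    { intros x y Hxy ([u v] & [Hu Hv] & [= -> ->]). cbn [fst snd] in *. apply Hxy. nra. }
    assert (Hfar : forall x y, (a - x)^2 + (b - y)^2 <= (e / 2)^2 -> dist2 (a, b) (x, y) < e).
    { intros x y Hxy. apply Rle_lt_trans with (e / 2); [|lra]. apply dist2_le; cbn [fst snd]; lra. }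
    destruct Hside as [-> | [-> | [-> | ->]]];
      [exists (-2 * r - e / 2, b)|exists (2 * r + e / 2, b)
      |exists (a, -2 * r - e / 2)|exists (a, 2 * r + e / 2)];
      (split; [apply Hout; lra|apply Hfar; apply Req_le; ring]).
Qed.

(** The bases are vertices of the dilated square, and the offsets of a side run along the edge
    between two of them. *)
Lemma offs_boundary n c j : (0 <= j <= 2 * Z.of_nat n)%Z ->
  boundary (dil_trans (INR n) 0 (1, 0) square) (toR2 (offs (Z.of_nat n) c j)).
Proof.
  intros Hj.
  assert (H0 : 0 <= IZR j <= 2 * INR n).
  { rewrite INR_IZR_INZ, <- mult_IZR. split; apply IZR_le; lia. }
  pose proof (pos_INR n).
  assert (HZ : toR2 (offs (Z.of_nat n) c j) =
    (IZR (fst (base (Z.of_nat n) c)) + IZR j * IZR (fst (dirn c)),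
     IZR (snd (base (Z.of_nat n) c)) + IZR j * IZR (snd (dirn c)))).
  { unfold toR2, offs, smul, addZ2. cbn [fst snd]. now rewrite !plus_IZR, !mult_IZR. }
  rewrite HZ.
  apply dilated_square_boundary; auto; destruct c; cbn [base dirn fst snd];
    rewrite !mult_IZR, <- INR_IZR_INZ; lra.
Qed.

(** The box contributes at most 74 and 44 and the tolerance 2 in each coordinate; 76^2 + 46^2 is
    below 100^2. *)
Lemma inbox_near q (o : Z * Z) X Y : inbox q = true ->
  -2 <= IZR (fst o) - X <= 2 -> -2 <= IZR (snd o) - Y <= 2 ->
  dist2 (toR2 (addZ2 q o)) (X, Y) <= IZR 100.
Proof.
  intros Hq HX HY. destruct q as [x y]. unfold inbox in Hq. cbn [fst snd] in Hq. boolz.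
  apply dist2_le; [lra|]. unfold toR2, addZ2. cbn [fst snd]. rewrite !plus_IZR.
  assert (0 <= IZR x <= 74) by (split; apply IZR_le; lia).
  assert (0 <= IZR y <= 44) by (split; apply IZR_le; lia).
  assert (Hs : forall a b, 0 <= b -> - b <= a <= b -> a^2 <= b^2) by (intros; nra).
  pose proof (Hs (IZR x + IZR (fst o) - X) 76 ltac:(lra) ltac:(lra)).
  pose proof (Hs (IZR y + IZR (snd o) - Y) 46 ltac:(lra) ltac:(lra)). lra.
Qed.

(** Rounding to a block number with error at most 1 displaces the offset by at most 2, the tolerance
    of [inbox_near]. *)
Lemma integer_below r (n : nat) : 0 <= r <= 2 * INR n ->
  exists j, (0 <= j <= 2 * Z.of_nat n)%Z /\ -1 <= IZR j - r <= 1.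
Proof.
  intros Hr. destruct (archimed r) as [H1 H2]. exists (up r - 1)%Z.
  rewrite minus_IZR. split; [|lra].
  assert (0 < up r)%Z by (apply lt_IZR; lra).
  assert (up r - 1 <= 2 * Z.of_nat n)%Z; [|lia].
  apply le_IZR. rewrite minus_IZR, mult_IZR, <- INR_IZR_INZ. lra.
Qed.

Lemma square_previsible :
  previsible_with square (trajectory w_LLRRRL (den start_square))
    (fun t => INR (cycle_of t)) (fun _ => 0) 100 (1, 0).
Proof.
  split; [intros; apply pos_INR|]. split; [intros; lra|].
  split; [intros m n Hmn; apply le_INR, cycle_of_mono, Hmn|].
  split; [intros m n _; lra|]. split; [intros [= H]; lra|]. split.
  - intros t. pose proof (cycle_of_spec t) as Ht. set (n := cycle_of t) in *.
    rewrite cycle_start_S in Ht.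
    destruct (square_near n (t - cycle_start n)) as (c & j & q & Hj & Hq & Hp); [lia|].
    replace (cycle_start n + (t - cycle_start n))%nat with t in Hp by lia.
    exists (toR2 (offs (Z.of_nat n) c j)). split; [now apply offs_boundary|].
    rewrite Hp. apply inbox_near; auto; unfold toR2; cbn [fst snd]; lra.
  - intros [a b] Hab N. apply square_boundary_inv in Hab. destruct Hab as (Ha & Hb & Hside).
    pose proof (pos_INR N) as HN.
    assert (Hgo : forall c j, is_side c = true -> (0 <= j <= 2 * Z.of_nat N)%Z ->
      -2 <= IZR (fst (offs (Z.of_nat N) c j)) - INR N * a <= 2 ->
      -2 <= IZR (snd (offs (Z.of_nat N) c j)) - INR N * b <= 2 ->
      exists n, (N <= n)%nat /\
        dist2 (toR2 (trajectory w_LLRRRL (den start_square) n))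
          (INR (cycle_of n) * a + 0 * 1, INR (cycle_of n) * b + 0 * 0) <= IZR 100).
    (* A visit in cycle [N] is late enough, since that cycle starts no earlier than step [N]. *)
    { intros c j Hc Hj H1 H2. destruct (square_visits N c j Hc Hj) as (i & q & Hi & Hq & Ht).
      exists (cycle_start N + i)%nat. split.
      - pose proof (cycle_start_mono 0 N ltac:(lia)). lia.
      - rewrite cycle_of_start, Ht by assumption.
        apply inbox_near; auto; lra. }
    cbn [fst snd].
    destruct Hside as [-> | [-> | [-> | ->]]].
    (* The copies on the left side run downwards, so the real block number solves
       [2 * N - 2 * j = N * b]; the other three sides are analogous. *)
    + destruct (integer_below (INR N * (2 - b) / 2) N) as (j & Hj & Hjr); [nra|].
      apply (Hgo LB j); auto; unfold offs, smul, addZ2; cbn [base dirn fst snd];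
        rewrite plus_IZR, !mult_IZR, <- INR_IZR_INZ; lra.
    + destruct (integer_below (INR N * (b + 2) / 2) N) as (j & Hj & Hjr); [nra|].
      apply (Hgo RB j); auto; unfold offs, smul, addZ2; cbn [base dirn fst snd];
        rewrite plus_IZR, !mult_IZR, <- INR_IZR_INZ; lra.
    + destruct (integer_below (INR N * (a + 2) / 2) N) as (j & Hj & Hjr); [nra|].
      apply (Hgo BB j); auto; unfold offs, smul, addZ2; cbn [base dirn fst snd];
        rewrite plus_IZR, !mult_IZR, <- INR_IZR_INZ; lra.
    + destruct (integer_below (INR N * (2 - a) / 2) N) as (j & Hj & Hjr); [nra|].
      apply (Hgo TB j); auto; unfold offs, smul, addZ2; cbn [base dirn fst snd];
        rewrite plus_IZR, !mult_IZR, <- INR_IZR_INZ; lra.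
Qed.

Lemma cycle_of_tends_to_infty : tends_to_infty (fun t => INR (cycle_of t)).
Proof.
  intros M. destruct (INR_unbounded M) as [n Hn]. exists (cycle_start n). intros t Ht.
  apply Rle_trans with (INR n); [lra|]. apply le_INR.
  pose proof (cycle_of_spec t) as H. destruct (Nat.le_gt_cases n (cycle_of t)) as [|Hlt]; [assumption|].
  pose proof (cycle_start_mono (S (cycle_of t)) n Hlt). lia.
Qed.

Lemma growing_square : exists C : ant_config,
  finite_config w_LLRRRL C /\ increasing_rectangle_behaviour w_LLRRRL C.
Proof.
  exists (den start_square). split.
  - apply den_finite; vm_compute; [lia|reflexivity].
  - split; [exists 0%nat; exact square_interlaced|].
    exists square, (fun t => INR (cycle_of t)), (fun _ => 0), 100%Z, (1, 0).
    split; [split; [apply square_closed|apply square_bounded]|].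
    split; [unfold square; cbn [fst snd]; lra|].
    split; [apply square_rectangle|].
    split; [apply square_previsible|].
    split; [apply cycle_of_tends_to_infty|].
    intros H. destruct (H 1) as [N HN]. specialize (HN N (Nat.le_refl N)). lra.
Qed.

Theorem theorem1 :
  (exists (C : ant_config) (n : nat) (a b : Z),
      is_highway w_LLRRRL C n a b /\ ~ diagonal_drift a b) /\
  (exists C : ant_config,
      finite_config w_LLRRRL C /\ increasing_rectangle_behaviour w_LLRRRL C) /\
  (exists H : nat -> ant_config,
      (forall i, exists (n : nat) (a b : Z),
          is_highway w_LLRRRL (H i) n a b /\ diagonal_drift a b) /\
      (forall i j, i <> j -> ~ highway_equiv w_LLRRRL (H i) (H j))).
Proof. exact (conj vertical_highway (conj growing_square diagonal_highways)). Qed.
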